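(* Assume complete randomization with vector potential outcomes and $\boldsymbol V_{\hat\gamma}$ nonsingular; let $\tilde\gamma=\boldsymbol V_{\hat\gamma}^{-1/2}(\hat\gamma-\mathbb E\hat\gamma)$. There is a universal constant $C>0$ such that: (i) for every $b\in\mathbb R^H$ with $\|b\|_2=1$, $$\sup_{t\in\mathbb R}|\mathbb P\{b^\top\tilde\gamma\le t\}-\Phi(t)|\le C\max_{i\in[N],q\in[Q]}\big|b^\top\boldsymbol V_{\hat\gamma}^{-1/2}N_q^{-1}\boldsymbol F_q\breve{\boldsymbol Y}_i(q)\big|;$$ (ii) if all $\boldsymbol S(q,q)$ are nonsingular and there is $\sigma_F\ge1$ with $\sum_{q=1}^QN_q^{-1}\boldsymbol F_q\boldsymbol S(q,q)\boldsymbol F_q^\top\preceq\sigma_F^2\boldsymbol V_{\hat\gamma}$, then $$\sup_{\|b\|_2=1}\sup_t|\mathbb P\{b^\top\tilde\gamma\le t\}-\Phi(t)|\le C\max_{i,q}\min\Big\{2\sigma_F\sqrt{N_q^{-1}\breve{\boldsymbol Y}_i(q)^\top\boldsymbol S(q,q)^{-1}\breve{\boldsymbol Y}_i(q)},\ \frac{\|\boldsymbol F_q\|_{2,1}N_q^{-1}\|\breve{\boldsymbol Y}_i(q)\|_\infty}{\sqrt{\varrho_{\min}(\boldsymbol V_{\hat\gamma})}}\Big\}.$$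
   Context: Randomization model with $N$ units, $Q$ treatment levels and group sizes $N_1,\dots,N_Q\ge1$, $\sum_qN_q=N$; unit $i$ has fixed vector potential outcomes $\boldsymbol Y_i(q)\in\mathbb R^p$. Under complete randomization $Z$ is uniform over all vectors in $[Q]^N$ with exactly $N_q$ coordinates equal to $q$. $\overline{\boldsymbol Y}(q)=N^{-1}\sum_i\boldsymbol Y_i(q)$, $\hat{\boldsymbol Y}_q=N_q^{-1}\sum_{i:Z_i=q}\boldsymbol Y_i(q)$, $\breve{\boldsymbol Y}_i(q)=\boldsymbol Y_i(q)-\overline{\boldsymbol Y}(q)$, $\boldsymbol S(q,q')=(N-1)^{-1}\sum_i\breve{\boldsymbol Y}_i(q)\breve{\boldsymbol Y}_i(q')^\top$. Fixed coefficient matrices $\boldsymbol F_1,\dots,\boldsymbol F_Q\in\mathbb R^{H\times p}$; $\hat\gamma=\sum_q\boldsymbol F_q\hat{\boldsymbol Y}_q$; $\gamma_i=\sum_q\boldsymbol F_q\boldsymbol Y_i(q)$, $\overline\gamma=N^{-1}\sum_i\gamma_i$, $\boldsymbol S_{\boldsymbol F}=(N-1)^{-1}\sum_i(\gamma_i-\overline\gamma)(\gamma_i-\overline\gamma)^\top$, and $\boldsymbol V_{\hat\gamma}=\sum_qN_q^{-1}\boldsymbol F_q\boldsymbol S(q,q)\boldsymbol F_q^\top-N^{-1}\boldsymbol S_{\boldsymbol F}$ (the covariance of $\hat\gamma$). $\|\boldsymbol F_q\|_{2,1}=\sum_{k=1}^p\|\boldsymbol F_q(\cdot,k)\|_2$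 (sum of Euclidean norms of columns); $\|x\|_\infty$ is the max absolute coordinate; $\varrho_{\min}$ the smallest eigenvalue; $\Phi$ the standard normal cdf. *)

(* Defs.v *)
From HB Require Import structures.
From mathcomp Require Import all_boot all_order all_algebra.
From mathcomp Require Import all_classical all_reals all_analysis.
From mathcomp Require Import normal_distribution.
Set Implicit Arguments. Unset Strict Implicit. Unset Printing Implicit Defensive.
Import Order.TTheory GRing.Theory Num.Theory.
Local Open Scope classical_set_scope.
Local Open Scope ring_scope.

Section Defs.
Variable R : realType.

Definition Phi (t : R) : R := fine (normal_prob 0 1 `]-oo, t]).

Variables (N Q p H : nat).

(* complete randomization: assignments with exactly Nq q units in arm q *)
Definition admissible (Nq : 'I_Q -> nat) : {set {ffun 'I_N -> 'I_Q}} :=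
  [set z : {ffun 'I_N -> 'I_Q} | [forall q, #|[set i | z i == q]| == Nq q]].

Definition prob_cr (Nq : 'I_Q -> nat) (E : {ffun 'I_N -> 'I_Q} -> bool) : R :=
  #|[set z in admissible Nq | E z]|%:R / #|admissible Nq|%:R.

Definition expect_cr (Nq : 'I_Q -> nat) (X : {ffun 'I_N -> 'I_Q} -> 'cV[R]_H)
  : 'cV[R]_H :=
  (#|admissible Nq|%:R)^-1 *: \sum_(z in admissible Nq) X z.

Variables (Nq : 'I_Q -> nat) (Y : 'I_N -> 'I_Q -> 'cV[R]_p)
          (F : 'I_Q -> 'M[R]_(H, p)).

Definition Ybar (q : 'I_Q) : 'cV[R]_p := (N%:R)^-1 *: \sum_i Y i q.
Definition Yhat (z : {ffun 'I_N -> 'I_Q}) (q : 'I_Q) : 'cV[R]_p :=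
  ((Nq q)%:R)^-1 *: \sum_(i | z i == q) Y i q.
Definition Ybrev (i : 'I_N) (q : 'I_Q) : 'cV[R]_p := Y i q - Ybar q.
Definition Scov (q q' : 'I_Q) : 'M[R]_p :=
  ((N - 1)%:R)^-1 *: \sum_i (Ybrev i q *m (Ybrev i q')^T).
Definition gammahat (z : {ffun 'I_N -> 'I_Q}) : 'cV[R]_H :=
  \sum_q F q *m Yhat z q.
Definition gamma_i (i : 'I_N) : 'cV[R]_H := \sum_q F q *m Y i q.
Definition gammabar : 'cV[R]_H := (N%:R)^-1 *: \sum_i gamma_i i.
Definition S_F : 'M[R]_H :=
  ((N - 1)%:R)^-1 *: \sum_i ((gamma_i i - gammabar) *m (gamma_i i - gammabar)^T).
Definition Vgamma : 'M[R]_H :=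
  \sum_q (((Nq q)%:R)^-1 *: (F q *m Scov q q *m (F q)^T)) - (N%:R)^-1 *: S_F.

End Defs.

Definition psd (R : realType) (n : nat) (M : 'M[R]_n) : Prop :=
  forall x : 'cV[R]_n, 0 <= (x^T *m M *m x) 0 0.
Definition pd (R : realType) (n : nat) (M : 'M[R]_n) : Prop :=
  forall x : 'cV[R]_n, x != 0 -> 0 < (x^T *m M *m x) 0 0.
Definition sym_mx (R : realType) (n : nat) (M : 'M[R]_n) : Prop := M^T = M.

Definition norm2 (R : realType) (n : nat) (x : 'cV[R]_n) : R :=
  Num.sqrt (\sum_k x k 0 ^+ 2).
Definition norminf (R : realType) (n : nat) (x : 'cV[R]_n) : R :=
  \big[Num.max/0]_k `|x k 0|.
Definition norm21 (R : realType) (h n : nat) (M : 'M[R]_(h, n)) : R :=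
  \sum_k norm2 (col k M).
Definition rho_min (R : realType) (n : nat) (M : 'M[R]_n) : R :=
  inf [set a : R | eigenvalue M a].

(* Main.v *)
Require Import Defs.
From HB Require Import structures.
From mathcomp Require Import all_boot all_order all_algebra all_fingroup.
From mathcomp Require Import all_classical all_reals all_analysis.
From mathcomp Require Import normal_distribution.
From mathcomp Require Import ring lra.
Set Implicit Arguments. Unset Strict Implicit. Unset Printing Implicit Defensive.
Import Order.TTheory GRing.Theory Num.Theory.
Import numFieldNormedType.Exports.
Local Open Scope ring_scope.

(** Along [b] the standardized estimator is a label sum [\sum_i c i (z i)]. Its
    law is that of a permutation statistic [W s = \sum_i a i (s i)] with doubly
    centred array [a], [\sum_(i, j) a i j ^+ 2 = N - 1], [|a| <= m = 2 max |c|].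
    The transposition pair, reweighted by its squared increment and coupled with a
    uniform permutation, gives a zero-bias coupling at distance [d = 12 m]: [E[W f W]] is
    an average of difference quotients of [f] taken within [d] of [W].  For
    the Stein solution [f] of [(-oo, z]], the mean value theorem compares such a
    quotient with [W f W + (W <= z +- d) - Phi z] up to [O(d (1 + W^2))], and
    [E[W^2] <= 1] together with the Lipschitz continuity of [Phi] gives (i)
    without any concentration inequality.  Part (ii) follows from (i) by
    Cauchy-Schwarz, in the form [S(q, q)] for the first term of the minimum
    and in the Euclidean form for the second. *)

(** * The standard normal distribution function *)

Section NormalCdf.
Local Open Scope classical_set_scope.
Variable R : realType.
Implicit Types x y z e : R.

Local Notation phi := (normal_pdf (0 : R) 1).

Lemma normal_pdf01E x : phi x = normal_peak 1 * expR (- (x ^+ 2) / 2).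
Proof.
by rewrite normal_pdfE ?oner_eq0// /normal_fun subr0 expr1n.
Qed.

Lemma normal_pdf01_gt0 x : 0 < phi x.
Proof.
by rewrite normal_pdf01E mulr_gt0 ?expR_gt0// normal_peak_gt0// oner_eq0.
Qed.

Lemma normal_pdf01_le1 x : phi x <= 1.
Proof.
apply: (le_trans (normal_pdf_ub _ _ _)); first by rewrite oner_eq0.
have := @pi_ge2 R => pi2.
rewrite /normal_peak expr1n mul1r invf_le1.
  by rewrite -[leLHS]sqrtr1 ler_sqrt; lra.
by rewrite sqrtr_gt0; lra.
Qed.

Lemma normal_pdf01N x : phi (- x) = phi x.
Proof. by rewrite !normal_pdf01E sqrrN. Qed.

Lemma is_derive_normal_pdf01 x : is_derive x 1 phi (- x * phi x).
Proof.
have -> : phi = (fun y => normal_peak 1 * expR (- (y ^+ 2) / 2)).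
  by apply/funext => y; exact: normal_pdf01E.
apply: is_derive_eq.
by rewrite /GRing.scale/=; field.
Qed.

Lemma Phi_Rintegral :
  @Phi R = fun t => (\int[lebesgue_measure]_(x in `]-oo, t]) phi x)%R.
Proof. by apply/funext => t; rewrite /Phi /normal_prob. Qed.

Lemma is_derive_Phi x : is_derive x 1 (@Phi R) (phi x).
Proof.
(* The endpoint [x + 1] makes [x] an interior point of the interval of integration, where the
   fundamental theorem gives a derivative. *)
have x1 : x < x + 1 by rewrite ltrDl.
have intphi : lebesgue_measure.-integrable `]-oo, x + 1] (EFin \o phi).
  by apply: (@integrableS _ _ _ _ setT) => //; exact: integrable_normal_pdf.
have cphi : {for x, continuous phi}.
  by apply: continuous_normal_pdf; rewrite oner_eq0.
have [] := continuous_FTC1 x1 intphi _ cphi; first by [rewrite ltNyr | rewrite bnd_simp].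
rewrite Phi_Rintegral => dF F'.
by apply: DeriveDef; [exact: dF | rewrite -derive1E].
Qed.

Lemma Phi_ge0 x : 0 <= Phi x.
Proof. by rewrite fine_ge0. Qed.

Lemma Phi_le1 x : Phi x <= 1.
Proof.
rewrite /Phi -lee_fin fineK; first exact: probability_le1.
by rewrite fin_num_measure.
Qed.

(** The identity as a random variable under the normal law: its [cdf] is [Phi], which yields the
    limits of [Phi] at both infinities. *)
Let idTR : measurableTypeR R -> R := idfun.

#[local] HB.instance Definition _ :=
  @isMeasurableFun.Build _ _ _ _ idTR (@measurable_id _ _ setT).

Lemma Phi_cdf x :
  (Phi x)%:E = cdf (idTR : {RV (normal_prob 0 1 : probability _ R) >-> R}) x.
Proof. rewrite /cdf/= /pushforward /Phi preimage_id fineK//.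
by rewrite fin_num_measure. Qed.

Lemma Phi_cvgNy0 : @Phi R x @[x --> -oo] --> (0 : R).
Proof.
have := cvg_cdfNy0 (idTR : {RV (normal_prob 0 1 : probability _ R) >-> R}).
rewrite (_ : cdf _ = EFin \o @Phi R); first exact: fine_cvg.
by apply/funext => x; rewrite -Phi_cdf.
Qed.

Lemma Phi_cvgy1 : @Phi R x @[x --> +oo] --> (1 : R).
Proof.
have := cvg_cdfy1 (idTR : {RV (normal_prob 0 1 : probability _ R) >-> R}).
rewrite (_ : cdf _ = EFin \o @Phi R); first exact: fine_cvg.
by apply/funext => x; rewrite -Phi_cdf.
Qed.

Lemma Phi_small x e : 0 < e -> exists2 y, y < x & Phi y < e.
Proof.
move=> e0; have /cvgrPdist_lt/(_ e e0) H := Phi_cvgNy0.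
near (ninfty_nbhs R) => y.
exists y; first by near: y; apply: nbhs_ninfty_lt; rewrite num_real.
have : `|0 - Phi y| < e by near: y.
by rewrite sub0r normrN ger0_norm// Phi_ge0.
Unshelve. all: by end_near. Qed.

Lemma Phi_large x e : 0 < e -> exists2 y, x < y & 1 - Phi y < e.
Proof.
move=> e0; have /cvgrPdist_lt/(_ e e0) H := Phi_cvgy1.
near (pinfty_nbhs R) => y.
exists y; first by near: y; apply: nbhs_pinfty_gt; rewrite num_real.
have : `|1 - Phi y| < e by near: y.
by rewrite ger0_norm// subr_ge0 Phi_le1.
Unshelve. all: by end_near. Qed.

(* [t |-> phi t / - t - G t] increases on the negative half-line, so if the
   inequality failed at [x], [G] would stay away from [0] left of [x]. *)
Lemma mills_le (G : R -> R) :
    (forall x, is_derive x 1 G (phi x)) ->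
    (forall x e, 0 < e -> exists2 y, y < x & G y < e) ->
  forall x, x <= 0 -> - x * G x <= phi x.
Proof.
move=> dG G0 x; rewrite le_eqVlt => /predU1P[->|x0].
  by rewrite oppr0 mul0r ltW ?normal_pdf01_gt0.
rewrite leNgt; apply/negP => xG.
pose e := G x - phi x / - x.
have e0 : 0 < e by rewrite subr_gt0 ltr_pdivrMr ?oppr_gt0// mulrC.
have [y yx Gy] := G0 x e e0.
pose g (t : R) := - (phi t * t^-1) - G t.
pose dg (t : R) := phi t / t ^+ 2.
have dgE (t : R) : t < 0 -> is_derive t 1 g (dg t).
  move=> t0; rewrite /g.
  have t1 : t != 0 by rewrite lt_eqF.
  have := is_derive_normal_pdf01 t => dp.
  have := dG t => dGt.
  have := @is_deriveV R id t 1 1 t1 (is_derive_id _ _) => dV.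
  apply: is_derive_eq.
  by rewrite /GRing.scale/= /dg; field.
have [||c /[!in_itv]/= /andP[yc cx] gE] := @MVT R g dg y x yx.
- by move=> t /[!in_itv]/= /andP[_ tx]; apply: dgE; apply: lt_trans tx _.
- apply: derivable_within_continuous => t /[!in_itv]/= /andP[_ tx].
  by have [] := dgE t (le_lt_trans tx x0).
have dgc : 0 < dg c.
  rewrite divr_gt0 ?normal_pdf01_gt0// exprn_even_gt0//=.
  by rewrite lt_eqF// (lt_trans cx).
have : 0 < g x - g y by rewrite gE mulr_gt0// subr_gt0.
have : 0 < phi y / - y.
  by rewrite divr_gt0 ?normal_pdf01_gt0// oppr_gt0 (lt_trans yx).
move: Gy; rewrite /e /g !invrN !mulrN; lra.
Qed.

Lemma Phi_mills x : x <= 0 -> - x * Phi x <= phi x.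
Proof. by apply: mills_le => *; [exact: is_derive_Phi | exact: Phi_small]. Qed.

(** This is [mills_le] for the reflection [1 - Phi (- t)], whose derivative is again the density
    because the density is even. *)
Lemma PhiC_mills x : 0 <= x -> x * (1 - Phi x) <= phi x.
Proof.
move=> x0.
have := @mills_le (fun t => 1 - Phi (- t)) _ _ (- x).
rewrite !opprK normal_pdf01N; apply; last by rewrite oppr_le0.
- move=> t.
  have dP : is_derive (- t) 1 (@Phi R) (phi t).
    by rewrite -normal_pdf01N; exact: is_derive_Phi.
  have dN : is_derive t 1 (fun t : R => - t) (- 1) by apply: is_derive_eq.
  have dPN : is_derive t 1 (@Phi R \o (fun t : R => - t)) (phi t * - 1).
    exact: is_derive1_comp.
  rewrite (_ : (fun t => _) = cst 1 - (@Phi R \o (fun t : R => - t)))//.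
  by apply: is_derive_eq; ring.
- move=> t e e0; have [y ty ye] := Phi_large (- t) e0.
  by exists (- y); rewrite ?opprK// ltrNl.
Qed.

Lemma Phi_le x y : x <= y -> Phi x <= Phi y.
Proof.
move=> xy; have [||c _ E] := @MVT_segment R (@Phi R) phi x y xy.
- by move=> t _; exact: is_derive_Phi.
- apply: derivable_within_continuous => t _.
  by have [] := is_derive_Phi t.
- by rewrite -subr_ge0 E mulr_ge0 ?subr_ge0// ltW ?normal_pdf01_gt0.
Qed.

Lemma Phi_lipschitz x y : x <= y -> Phi y - Phi x <= y - x.
Proof.
move=> xy; have [||c _ ->] := @MVT_segment R (@Phi R) phi x y xy.
- by move=> t _; exact: is_derive_Phi.
- apply: derivable_within_continuous => t _.
  by have [] := is_derive_Phi t.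
- by rewrite ler_piMl ?subr_ge0// normal_pdf01_le1.
Qed.

End NormalCdf.

(** * The Stein equation *)

Section SteinEquation.
Local Open Scope classical_set_scope.
Variable R : realType.
Implicit Types x y z w a b d : R.

Local Notation phi := (normal_pdf (0 : R) 1).

(** The Stein solution has a kink at [z], so the mean value theorem is applied on each side of [z]
    to a branch differentiable everywhere, and the two increments are added. A derivative bound is
    asked only on a side not reduced to a point; the strict [z < b] decides an indicator in
    [stein_sol_increment]. *)
Lemma glued_increment_le (f f1 f2 d1 d2 : R -> R) z a b m :
    (forall x, is_derive x 1 f1 (d1 x)) -> (forall x, is_derive x 1 f2 (d2 x)) ->
    (forall x, x <= z -> f x = f1 x) -> (forall x, z <= x -> f x = f2 x) ->
    a <= b ->
    (forall c, a <= c <= b -> c <= z -> a < z -> d1 c <= m) ->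
    (forall c, a <= c <= b -> z <= c -> z < b -> d2 c <= m) ->
  f b - f a <= m * (b - a).
Proof.
move=> D1 D2 f1E f2E ab d1m d2m.
have mvt (g dg : R -> R) u v : (forall x, is_derive x 1 g (dg x)) -> u <= v ->
    (forall c, u <= c <= v -> u < v -> dg c <= m) -> g v - g u <= m * (v - u).
  move=> Dg; rewrite le_eqVlt => /predU1P[->|uv dgm]; first by rewrite !subrr mulr0.
  have cg : {within `[u, v], continuous g}.
    by apply: derivable_within_continuous => x _; have [] := Dg x.
  have [c /[!in_itv]/= cuv ->] := MVT_segment (ltW uv) (fun x _ => Dg x) cg.
  by apply: ler_wpM2r; [rewrite subr_ge0 ltW | exact: dgm].
have left u v : a <= u -> u <= v -> v <= b -> v <= z -> f v - f u <= m * (v - u).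
  move=> au uv vb vz; rewrite !f1E//; last exact: le_trans vz.
  apply: (mvt _ d1) => // c /andP[uc cv] ltuv.
  by apply: d1m; lra.
have right u v : a <= u -> u <= v -> v <= b -> z <= u -> f v - f u <= m * (v - u).
  move=> au uv vb vz; rewrite !f2E//; last exact: le_trans vz _.
  apply: (mvt _ d2) => // c /andP[uc cv] ltuv.
  by apply: d2m; lra.
have [bz|zb] := leP b z; first exact: left.
have [za|az] := leP z a; first exact: right.
have := left a z (lexx _) (ltW az) (ltW zb) (lexx _).
have := right z b (ltW az) (ltW zb) (lexx _) (lexx _).
by lra.
Qed.

Lemma glued_increment_ge (f f1 f2 d1 d2 : R -> R) z a b m :
    (forall x, is_derive x 1 f1 (d1 x)) -> (forall x, is_derive x 1 f2 (d2 x)) ->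
    (forall x, x <= z -> f x = f1 x) -> (forall x, z <= x -> f x = f2 x) ->
    a <= b ->
    (forall c, a <= c <= b -> c <= z -> a < z -> m <= d1 c) ->
    (forall c, a <= c <= b -> z <= c -> z < b -> m <= d2 c) ->
  m * (b - a) <= f b - f a.
Proof.
move=> D1 D2 f1E f2E ab d1m d2m.
suff : - f b - - f a <= - m * (b - a) by lra.
apply: (@glued_increment_le (fun x => - f x) (fun x => - f1 x) (fun x => - f2 x)
  (fun x => - d1 x) (fun x => - d2 x) z) => //.
- by move=> x xz; rewrite f1E.
- by move=> x xz; rewrite f2E.
- by move=> c ? ? ?; rewrite lerN2 d1m.
- by move=> c ? ? ?; rewrite lerN2 d2m.
Qed.

(** The Mills ratios [lmills] and [rmills] solve [f' - x f = 1] and [f' - x f = -1]; the Stein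
    solution is a multiple of one of them on each side of [z]. *)
Definition lmills x : R := Phi x / phi x.
Definition rmills x : R := (1 - Phi x) / phi x.

Let phi_neq0 x : phi x != 0. Proof. by rewrite gt_eqF// normal_pdf01_gt0. Qed.

Lemma is_derive_lmills x : is_derive x 1 lmills (1 + x * lmills x).
Proof.
have := is_derive_normal_pdf01 x => dp; have := is_derive_Phi x => dP.
have p0 := phi_neq0 x.
rewrite (_ : lmills = @Phi R * (fun t => (phi t)^-1)); last exact/funext.
apply: is_derive_eq.
by rewrite /GRing.scale/= !fctE/=; field.
Qed.

Lemma is_derive_rmills x : is_derive x 1 rmills (x * rmills x - 1).
Proof.
have := is_derive_normal_pdf01 x => dp; have := is_derive_Phi x => dP.
have p0 := phi_neq0 x.
rewrite (_ : rmills = (cst 1 - @Phi R) * (fun t => (phi t)^-1)); last exact/funext.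
apply: is_derive_eq.
by rewrite /GRing.scale/= !fctE/=; field.
Qed.

(* The bounded solution of [f' x - x f x = (x <= z)%:R - Phi z], [x != z]. *)
Definition stein_sol z x : R :=
  if x <= z then (1 - Phi z) * lmills x else Phi z * rmills x.

Lemma stein_solE_le z x : x <= z -> stein_sol z x = (1 - Phi z) * lmills x.
Proof. by rewrite /stein_sol => ->. Qed.

(** The two branches agree at [z], so each formula holds on a closed half-line, as the gluing lemmas
    require. *)
Lemma stein_solE_ge z x : z <= x -> stein_sol z x = Phi z * rmills x.
Proof.
rewrite /stein_sol le_eqVlt => /predU1P[->|]; last by rewrite ltNge; case: ifP.
by rewrite lexx /lmills /rmills; ring.
Qed.

Lemma stein_sol_ge0 z x : 0 <= stein_sol z x.
Proof.
have p0 := normal_pdf01_gt0 x; have := Phi_le1 x; have := Phi_le1 z => z1 x1.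
have := Phi_ge0 x; have := Phi_ge0 z => z0 x0.
have V0 : 0 <= (phi x)^-1 by rewrite invr_ge0 ltW.
by rewrite /stein_sol; case: ifP => _; rewrite !mulr_ge0 ?subr_ge0.
Qed.

(** Monotonicity of [Phi] replaces [z] by [x], which gives an envelope free of [z]. *)
Lemma stein_sol_le z x : stein_sol z x <= Phi x * (1 - Phi x) / phi x.
Proof.
have V0 : 0 <= (phi x)^-1 by rewrite invr_ge0 ltW ?normal_pdf01_gt0.
rewrite /stein_sol; case: (leP x z) => [|/ltW] xz.
  rewrite /lmills mulrA ler_wpM2r// mulrC ler_wpM2l ?Phi_ge0//.
  by rewrite lerD2l lerN2 Phi_le.
rewrite /rmills mulrA ler_wpM2r// ler_wpM2r ?subr_ge0 ?Phi_le1//.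
by rewrite Phi_le.
Qed.

(** Mills' inequality controls the tail on the side of [x]; the other factor of the envelope is at
    most [1]. *)
Lemma stein_sol_norm_mul z x : `|x * stein_sol z x| <= 1.
Proof.
have p0 := normal_pdf01_gt0 x.
rewrite normrM (ger0_norm (stein_sol_ge0 _ _)).
apply: (le_trans (ler_wpM2l (normr_ge0 _) (stein_sol_le _ _))).
rewrite mulrA ler_pdivrMr// mul1r.
have Px := Phi_ge0 x; have P1 := Phi_le1 x.
have [x0|/ltW x0] := leP 0 x.
  rewrite ger0_norm//; apply: le_trans (PhiC_mills x0).
  by rewrite ler_wpM2l// ler_piMl ?subr_ge0.
rewrite ler0_norm//; apply: le_trans (Phi_mills x0).
by rewrite ler_wpM2l ?oppr_ge0// ler_piMr// lerBlDr lerDl.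
Qed.

(** The summands serve two ranges: for [|x| <= 1] the envelope is at most [1 / phi 1], and for
    [|x| > 1] the bound on [x * f x] gives [f x <= 1]. *)
Definition stein_bound : R := 1 + (phi 1)^-1.

Lemma stein_bound_gt0 : 0 < stein_bound.
Proof. by rewrite addr_gt0// invr_gt0 normal_pdf01_gt0. Qed.

Lemma stein_sol_bounded z x : stein_sol z x <= stein_bound.
Proof.
have V0 : 0 < (phi 1)^-1 by rewrite invr_gt0 normal_pdf01_gt0.
have [x1|x1] := leP `|x| 1.
  apply: (le_trans (stein_sol_le _ _)).
  suff : Phi x * (1 - Phi x) / phi x <= (phi 1)^-1 by rewrite /stein_bound; lra.
  have p0 := normal_pdf01_gt0 x; have p1 := normal_pdf01_gt0 (1 : R).
  rewrite ler_pdivrMr// (@le_trans _ _ 1)//.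
    have Px := Phi_ge0 x; have P1 := Phi_le1 x; nra.
  rewrite mulrC ler_pdivlMr// mul1r !normal_pdf01E ler_wpM2l ?normal_peak_ge0//.
  rewrite ler_expR ler_wpM2r// lerN2 -(real_normK (num_real x)).
  by rewrite expr1n expr_le1.
apply: (@le_trans _ _ 1); last by rewrite lerDl ltW.
have := stein_sol_norm_mul z x; rewrite normrM (ger0_norm (stein_sol_ge0 _ _)).
have := stein_sol_ge0 z x; nra.
Qed.

(** By the Stein equation the derivative of [x * f x] is [f x + x * (x * f x + r)], with [r] equal
    to [1 - Phi z] or [- Phi z]. As [d <= 1], only points within [1] of [w] matter; there it is at
    most [stein_bound + 2 (|w| + 1)], and [2 |w| <= 1 + w^2] turns this into the stated growth. *)
Lemma stein_sol_mul_lipschitz z w c d : 0 <= d <= 1 -> `|c - w| <= d ->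
  `|c * stein_sol z c - w * stein_sol z w| <=
    (stein_bound + 3) * (1 + w ^+ 2) * d.
Proof.
move=> /andP[d0 d1] cwd; set f := stein_sol z; set B := _ * (1 + _).
have B0 : 0 <= B.
  by have := stein_bound_gt0; have := sqr_ge0 w => *; apply: mulr_ge0; lra.
pose f1 x := x * ((1 - Phi z) * lmills x).
pose f2 x := x * (Phi z * rmills x).
pose d1' x := (1 - Phi z) * lmills x + x * ((1 - Phi z) * (1 + x * lmills x)).
pose d2' x := Phi z * rmills x + x * (Phi z * (x * rmills x - 1)).
have D1 x : is_derive x 1 f1 (d1' x).
  have := is_derive_lmills x => dl.
  by apply: is_derive_eq; rewrite /GRing.scale/= /d1'; ring.
have D2 x : is_derive x 1 f2 (d2' x).
  have := is_derive_rmills x => dl.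
  by apply: is_derive_eq; rewrite /GRing.scale/= /d2'; ring.
have P0 := Phi_ge0 z; have P1 := Phi_le1 z.
have bnd (x r : R) : `|x - w| <= 1 -> `|r| <= 1 ->
    `|f x + x * (x * f x + r)| <= B.
  move=> xw r1.
  have F0 : `|f x| <= stein_bound.
    by rewrite ger0_norm ?stein_sol_ge0// stein_sol_bounded.
  have F1 : `|x * f x + r| <= 2.
    by apply: (le_trans (ler_normD _ _)); have := stein_sol_norm_mul z x; rewrite /f; lra.
  apply: (le_trans (ler_normD _ _)); rewrite normrM.
  have X1 : `|x| <= `|w| + 1.
    by rewrite -(subrK w x); apply: (le_trans (ler_normD _ _)); lra.
  have W2 : 2 * `|w| <= 1 + w ^+ 2.
    by rewrite -(real_normK (num_real w)); have := sqr_ge0 (`|w| - 1); nra.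
  have XF : `|x| * `|x * f x + r| <= (`|w| + 1) * 2 by rewrite ler_pM.
  have := sqr_ge0 w; have := stein_bound_gt0; rewrite /B; nra.
have f1E x : x <= z -> x * f x = f1 x by move=> ?; rewrite /f stein_solE_le.
have f2E x : z <= x -> x * f x = f2 x by move=> ?; rewrite /f stein_solE_ge.
have E1 x : x <= z -> d1' x = f x + x * (x * f x + (1 - Phi z)).
  by move=> xz; rewrite /f stein_solE_le// /d1'; ring.
have E2 x : z <= x -> d2' x = f x + x * (x * f x + - Phi z).
  by move=> xz; rewrite /f stein_solE_ge// /d2'; ring.
have r1 : `|1 - Phi z| <= 1 by rewrite ger0_norm; lra.
have r2 : `|- Phi z| <= 1 by rewrite normrN ger0_norm; lra.
have key a b : a <= b -> `|a - w| <= 1 -> `|b - w| <= 1 ->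
    `|b * f b - a * f a| <= B * (b - a).
  move=> ab; rewrite !ler_norml => /andP[a1 a2] /andP[b1 b2].
  rewrite -mulNr.
  apply/andP; split.
    apply: (glued_increment_ge (f := fun x => x * f x) D1 D2 f1E f2E ab) => t.
    - move=> /andP[ta tb] tz _; have : `|d1' t| <= B.
        by rewrite E1// bnd// ler_norml; lra.
      by rewrite ler_norml => /andP[].
    - move=> /andP[ta tb] tz _; have : `|d2' t| <= B.
        by rewrite E2// bnd// ler_norml; lra.
      by rewrite ler_norml => /andP[].
  apply: (glued_increment_le (f := fun x => x * f x) D1 D2 f1E f2E ab) => t.
  - move=> /andP[ta tb] tz _; have : `|d1' t| <= B.
      by rewrite E1// bnd// ler_norml; lra.
    by rewrite ler_norml => /andP[].
  - move=> /andP[ta tb] tz _; have : `|d2' t| <= B.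
      by rewrite E2// bnd// ler_norml; lra.
    by rewrite ler_norml => /andP[].
have w1 : `|w - w| <= 1 by rewrite subrr normr0.
have c1 : `|c - w| <= 1 by apply: le_trans cwd _.
have [cw|/ltW wc] := leP c w.
  rewrite distrC; apply: (le_trans (key _ _ cw c1 w1)).
  by rewrite ler_wpM2l//; move: cwd; rewrite ler_norml; lra.
apply: (le_trans (key _ _ wc w1 c1)).
by rewrite ler_wpM2l//; move: cwd; rewrite ler_norml; lra.
Qed.

(** Between [x] and [y] the derivative of [f] at [t] is [t f t + (t <= z) - Phi z]. Here [t f t]
    differs from [w f w] by at most [L], and the indicator lies between those of [w <= z - d] and
    [w <= z + d]. *)
Lemma stein_sol_increment z w x y d (f := stein_sol z)
    (L := (stein_bound + 3) * (1 + w ^+ 2) * d) :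
    0 <= d <= 1 -> `|x - w| <= d -> `|y - w| <= d ->
  (x - y) ^+ 2 * (w * f w - L + (w <= z - d)%R%:R - Phi z)
    <= (x - y) * (f x - f y)
    <= (x - y) ^+ 2 * (w * f w + L + (w <= z + d)%R%:R - Phi z).
Proof.
move=> d01; wlog yx : x y / y <= x.
  move=> H xd yd; have [yx|/ltW xy] := leP y x; first exact: H.
  have := H y x xy yd xd.
  rewrite (_ : (y - x) ^+ 2 = (x - y) ^+ 2); last by ring.
  by rewrite (_ : (y - x) * (f y - f x) = (x - y) * (f x - f y)); last by ring.
rewrite !ler_norml => /andP[x1 x2] /andP[y1 y2].
pose d1' (t : R) : R := (1 - Phi z) * (1 + t * lmills t).
pose d2' (t : R) : R := Phi z * (t * rmills t - 1).
have D1 (t : R) : is_derive t 1 (fun x => (1 - Phi z) * lmills x) (d1' t).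
  have := is_derive_lmills t => dl.
  by apply: is_derive_eq; rewrite /GRing.scale/= /d1'; ring.
have D2 (t : R) : is_derive t 1 (fun x => Phi z * rmills x) (d2' t).
  have := is_derive_rmills t => dl.
  by apply: is_derive_eq; rewrite /GRing.scale/= /d2'; ring.
have E1 t : t <= z -> d1' t = t * f t + 1 - Phi z.
  by move=> tz; rewrite /f stein_solE_le// /d1'; ring.
have E2 t : z <= t -> d2' t = t * f t - Phi z.
  by move=> tz; rewrite /f stein_solE_ge// /d2'; ring.
have lip t : y <= t <= x -> `|t * f t - w * f w| <= L.
  by move=> /andP[yt tx]; apply: stein_sol_mul_lipschitz => //; rewrite ler_norml; lra.
have yx0 : 0 <= x - y by rewrite subr_ge0.
rewrite !expr2 -!mulrA.
apply/andP; split; rewrite ler_wpM2l// mulrC.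
  apply: (glued_increment_ge D1 D2 (@stein_solE_le z) (@stein_solE_ge z) yx) => t tyx.
  - move=> tz _; rewrite E1//.
    have := lip t tyx; rewrite ler_norml.
    by case: (w <= z - d) => /=; lra.
  (* Since [z < x <= w + d], the indicator of [w <= z - d] vanishes. *)
  - move=> tz zx; rewrite E2//.
    have := lip t tyx; rewrite ler_norml.
    by rewrite (_ : (w <= z - d) = false) /=; [lra|apply/negbTE; rewrite -ltNge; lra].
apply: (glued_increment_le D1 D2 (@stein_solE_le z) (@stein_solE_ge z) yx) => t tyx.
- move=> tz yz; rewrite E1//.
  have := lip t tyx; rewrite ler_norml.
  by rewrite (_ : (w <= z + d) = true) /=; lra.
- move=> tz _; rewrite E2//.
  have := lip t tyx; rewrite ler_norml.
  by case: (w <= z + d) => /=; lra.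
Qed.

End SteinEquation.

(** * Zero-bias coupling for permutation statistics *)

Section PermutationStatistic.
Variables (R : realType) (N : nat) (a : 'I_N -> 'I_N -> R).
Implicit Types (s u : 'S_N) (i j k l : 'I_N) (f U : R -> R) (m : R).

Definition perm_stat s : R := \sum_i a i (s i).

Definition perm_mean (X : 'S_N -> R) : R := (N`!%:R)^-1 * \sum_(s : 'S_N) X s.

(** The drop of the statistic when [i] and [j], with images [k] and [l], swap these images. *)
Definition exchange i j k l : R := a i k + a j l - a i l - a j k.

Lemma exchange_ii i k l : exchange i i k l = 0.
Proof. by rewrite /exchange; ring. Qed.

Lemma exchange_kk i j k : exchange i j k k = 0.
Proof. by rewrite /exchange; ring. Qed.

Lemma perm_stat_tperm s i j :
  perm_stat s - perm_stat (tperm i j * s)%g = exchange i j (s i) (s j).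
Proof.
have [->|ij] := eqVneq i j.
  by rewrite tperm1 mul1g subrr exchange_ii.
rewrite /perm_stat -sumrB (bigD1 i)//= (bigD1 j) 1?eq_sym//=.
rewrite !permM tpermL tpermR big1 ?addr0 /exchange; first by ring.
move=> k /andP[ki kj]; rewrite permM tpermD ?subrr// eq_sym//.
Qed.

(** Swapping two values amounts to swapping their two preimages, by conjugation; only four entries
    of [a] are then involved. *)
Lemma perm_stat_mul_tperm m s k l : (forall i j, `|a i j| <= m) ->
  `|perm_stat (s * tperm k l)%g - perm_stat s| <= 4 * m.
Proof.
move=> am; set i := (s^-1)%g k; set j := (s^-1)%g l.
have -> : (s * tperm k l = tperm i j * s)%g.
  by rewrite (conjgC (tperm i j) s) tpermJ !permKV.
rewrite distrC perm_stat_tperm /exchange.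
have := am i (s i); have := am j (s j); have := am i (s j); have := am j (s i).
by rewrite !ler_norml; lra.
Qed.

(** It carries the pair of values [(k', l')] to [(k, l)]. Being a product of two transpositions, it
    changes the statistic by at most [8 * m]. *)
Definition move_to k' l' k l : 'S_N :=
  (tperm k' k * tperm (tperm k' k l') l)%g.

Lemma move_toL k' l' k l : k' != l' -> k != l -> move_to k' l' k l k' = k.
Proof.
move=> kl' kl; rewrite permM tpermL.
(* The second transposition fixes [k]: it swaps [l] with the image of [l'], and neither is [k]. *)
have k'k : tperm k' k l' != k.
  by rewrite -[X in _ != X](tpermL k' k) (inj_eq perm_inj) eq_sym.
by apply: tpermD => //; rewrite eq_sym.
Qed.

Lemma move_toR k' l' k l : move_to k' l' k l l' = l.
Proof. by rewrite permM tpermL. Qed.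

Lemma perm_stat_move_to m s k' l' k l : (forall i j, `|a i j| <= m) ->
  `|perm_stat (s * move_to k' l' k l)%g - perm_stat s| <= 8 * m.
Proof.
move=> am; rewrite mulgA.
have := perm_stat_mul_tperm s k' k am.
have := perm_stat_mul_tperm (s * tperm k' k)%g (tperm k' k l') l am.
by rewrite !ler_norml; lra.
Qed.

(** From a uniform [s] this produces a permutation uniform among those with [i] sent to [k] and [j]
    to [l]: right multiplication maps each of the [N (N - 1)] fibres of [(s i, s j)] bijectively
    onto that set. *)
Lemma sum_perm_move_to i j k l (G : 'S_N -> R) : i != j -> k != l ->
  \sum_(s : 'S_N) G (s * move_to (s i) (s j) k l)%g
  = N%:R * (N - 1)%:R * \sum_(s : 'S_N | (s i == k) && (s j == l)) G s.
Proof.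
move=> ij kl.
rewrite (partition_big (fun s : 'S_N => (s i, s j)) (fun q => q.1 != q.2))/=; last first.
  by move=> s _; rewrite (inj_eq perm_inj).
rewrite (eq_bigr (fun=> \sum_(s : 'S_N | (s i == k) && (s j == l)) G s)); last first.
  move=> [k' l'] /= kl'; set r := move_to k' l' k l.
  rewrite [RHS](reindex_inj (mulIg r)).
  apply: eq_big => [s|s /eqP[-> ->]//].
  rewrite xpair_eqE (permM s r i) (permM s r j).
  rewrite -(inj_eq (@perm_inj _ r) (s i)) -(inj_eq (@perm_inj _ r) (s j)).
  by rewrite /r move_toL// move_toR.
set c := \sum_(s : 'S_N | (s i == k) && (s j == l)) G s.
transitivity (\sum_(k' : 'I_N) \sum_(l' in predC1 k') c).
  by rewrite [RHS]pair_big_dep; apply: eq_bigl => -[x y]/=; rewrite inE eq_sym.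
under eq_bigr => k' _ do rewrite sumr_const cardC1 card_ord.
by rewrite sumr_const card_ord -subn1 -mulrnA -[c *+ _]mulr_natl natrM; congr (_ * _); exact: mulrC.
Qed.

Lemma sum_sqr_sub (b : 'I_N -> R) : \sum_k b k = 0 ->
  \sum_k \sum_l (b k - b l) ^+ 2 = 2 * N%:R * \sum_k b k ^+ 2.
Proof.
move=> b0.
transitivity (\sum_k \sum_l (b k ^+ 2 + b l ^+ 2 - 2 * b k * b l)).
  by do 2!apply: eq_bigr => ? _; ring.
have cross k : \sum_l 2 * b k * b l = 0 by rewrite -mulr_sumr b0 mulr0.
have sqr k : \sum_(l < N) b k ^+ 2 = N%:R * b k ^+ 2.
  by rewrite sumr_const card_ord mulr_natl.
under eq_bigr => k _ do rewrite sumrB big_split/= cross subr0 sqr.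
by rewrite big_split/= -mulr_sumr sumr_const card_ord -mulr_natl; ring.
Qed.

Hypothesis row0 : forall i, \sum_j a i j = 0.
Hypothesis col0 : forall j, \sum_i a i j = 0.
Hypothesis var1 : \sum_i \sum_j a i j ^+ 2 = (N - 1)%:R.
Hypothesis N_ge2 : (2 <= N)%N.

(** As [exchange] is a second difference of [a], [sum_sqr_sub] applies twice: over [(k, l)] by
    centred rows, then over [(i, j)] by centred columns. *)
Lemma sum_sqr_exchange : \sum_i \sum_j \sum_k \sum_l exchange i j k l ^+ 2
  = 4 * N%:R ^+ 2 * (N - 1)%:R.
Proof.
transitivity (\sum_i \sum_j 2 * N%:R * \sum_k (a i k - a j k) ^+ 2).
  apply: eq_bigr => i _; apply: eq_bigr => j _.
  rewrite -sum_sqr_sub; last by rewrite sumrB !row0 subrr.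
  by do 2!apply: eq_bigr => ? _; rewrite /exchange; ring.
under eq_bigr => i _ do rewrite -mulr_sumr exchange_big/=.
rewrite -mulr_sumr exchange_big/=.
under eq_bigr => k _ do rewrite sum_sqr_sub//.
rewrite -mulr_sumr exchange_big/= var1; ring.
Qed.

(** The linear regression property of the exchangeable pair: summed over all transpositions, the
    increment is proportional to the statistic, double centring having removed the cross terms. *)
Lemma sum_exchange s : \sum_i \sum_j exchange i j (s i) (s j) = 2 * N%:R * perm_stat s.
Proof.
have E i : \sum_j exchange i j (s i) (s j) =
    N%:R * a i (s i) + perm_stat s - 0 - \sum_j a j (s i).
  have -> : N%:R * a i (s i) = \sum_(j < N) a i (s i).
    by rewrite sumr_const card_ord mulr_natl.
  have rs : \sum_j a i (s j) = 0.
    by rewrite -[RHS](row0 i) [RHS](reindex_inj (@perm_inj _ s)).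
  by rewrite /exchange !sumrB big_split/= rs.
under eq_bigr => i _ do rewrite E col0 !subr0.
by rewrite big_split/= -mulr_sumr sumr_const card_ord -mulr_natl /perm_stat; ring.
Qed.

(* The transposition exchangeable pair [(s, tperm i j * s)], conditioned on
   [s i = k] and [s j = l] and coupled with a uniform permutation by [move_to];
   weighting by [exchange i j k l ^+ 2] is the zero-bias coupling. *)
Lemma perm_stat_zero_bias m f U : (forall i j, `|a i j| <= m) ->
    (forall w x y, `|x - w| <= 12 * m -> `|y - w| <= 12 * m ->
       (x - y) * (f x - f y) <= (x - y) ^+ 2 * U w) ->
  perm_mean (fun s => perm_stat s * f (perm_stat s))
    <= perm_mean (fun s => U (perm_stat s)).
Proof.
move=> am fU; set W := perm_stat; rewrite /perm_mean.
rewrite ler_wpM2l ?invr_ge0//.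
have N0 : 0 < N%:R :> R by rewrite ltr0n (leq_trans _ N_ge2).
have N1 : 0 < (N - 1)%:R :> R by rewrite ltr0n subn_gt0.
pose D i j s := (W s - W (tperm i j * s)%g) * (f (W s) - f (W (tperm i j * s)%g)).
(* The regression property gives half of the right-hand side; the other half is its image under the
   involution [s -> tperm i j * s], which flips the sign of the increment. *)
have sumD : 4 * N%:R * \sum_(s : 'S_N) W s * f (W s) = \sum_i \sum_j \sum_(s : 'S_N) D i j s.
  transitivity (2 * \sum_(s : 'S_N) \sum_i \sum_j exchange i j (s i) (s j) * f (W s)).
    rewrite [in RHS](eq_bigr (fun s => 2 * N%:R * (W s * f (W s)))); last first.
      move=> s _; rewrite mulrA -sum_exchange mulr_suml.
      by apply: eq_bigr => i _; rewrite mulr_suml.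
    by rewrite -mulr_sumr; ring.
  rewrite exchange_big/= mulr_sumr; apply: eq_bigr => i _.
  rewrite exchange_big/= mulr_sumr; apply: eq_bigr => j _.
  rewrite /D (eq_bigr (fun s => (W s - W (tperm i j * s)%g) * f (W s))); last first.
    by move=> s _; rewrite perm_stat_tperm.
  transitivity (\sum_(s : 'S_N) (W s - W (tperm i j * s)%g) * f (W s)
     + \sum_(s : 'S_N) (W (tperm i j * s)%g - W s) * f (W (tperm i j * s)%g)); last first.
    by rewrite -big_split/=; apply: eq_bigr => s _; ring.
  rewrite mulr_natl mulr2n; congr (_ + _).
  rewrite (reindex_inj (mulgI (tperm i j)))/=; apply: eq_bigr => s _.
  by rewrite mulgA tperm2 mul1g.
have bound i j : N%:R * (N - 1)%:R * \sum_(s : 'S_N) D i j s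
    <= (\sum_k \sum_l exchange i j k l ^+ 2) * \sum_(s : 'S_N) U (W s).
  have [<-|ij] := eqVneq i j.
    rewrite big1 => [|s _]; last by rewrite /D tperm1 mul1g subrr mul0r.
    rewrite mulr0 big1 ?mul0r// => k _; rewrite big1// => l _.
    by rewrite exchange_ii expr0n.
  rewrite (partition_big (fun s : 'S_N => (s i, s j)) (fun q => q.1 != q.2))/=; last first.
    by move=> s _; rewrite (inj_eq perm_inj).
  rewrite pair_big/= mulr_sumr mulr_suml.
  rewrite [leRHS](bigID (fun q => q.1 != q.2))/= [X in _ <= _ + X]big1 ?addr0; last first.
    by move=> [k l]/= /negPn/eqP->; rewrite exchange_kk expr0n mul0r.
  apply: ler_sum => -[k l]/= kl.
  rewrite (eq_bigl (fun s : 'S_N => (s i == k) && (s j == l))); last first.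
    by move=> s; rewrite xpair_eqE.
  rewrite -sum_perm_move_to// mulr_sumr; apply: ler_sum => s _.
  (* The increment of the pair is taken at the constrained permutation [u], where it equals
     [exchange i j k l], while [U] is evaluated at the uniform [s]. This decouples the weight from
     the permutation. *)
  set u := (s * _)%g.
  have ui : u i = k by rewrite permM move_toL// (inj_eq perm_inj).
  have uj : u j = l by rewrite permM move_toR.
  have := perm_stat_tperm u i j; rewrite ui uj => dE.
  rewrite -dE; apply: fU.
    have m0 := le_trans (normr_ge0 _) (am i i).
    by apply: (le_trans (perm_stat_move_to _ _ _ _ _ am)); lra.
  (* The radius [12 * m] is [8 * m] from [s] to [u], plus [4 * m] for the final transposition. *)
  have := perm_stat_move_to s (s i) (s j) k l am; rewrite -/u -/W => d8.
  have := am i k; have := am j l; have := am i l; have := am j k.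
  move: dE d8; rewrite /exchange -/W !ler_norml; lra.
have : N%:R * (N - 1)%:R * (4 * N%:R * \sum_(s : 'S_N) W s * f (W s))
    <= 4 * N%:R ^+ 2 * (N - 1)%:R * \sum_(s : 'S_N) U (W s).
  rewrite sumD -sum_sqr_exchange mulr_sumr mulr_suml; apply: ler_sum => i _.
  by rewrite mulr_sumr mulr_suml; apply: ler_sum => j _; exact: bound.
rewrite (_ : N%:R * (N - 1)%:R * (4 * N%:R * \sum_(s : 'S_N) W s * f (W s)) =
  4 * N%:R ^+ 2 * (N - 1)%:R * \sum_(s : 'S_N) W s * f (W s)); last by ring.
by rewrite ler_pM2l// !mulr_gt0 ?exprn_gt0.
Qed.

(** Constant test functions [1] and [-1] have zero increments, so [U = 0] is allowed and gives both
    inequalities; any bound [m] on the entries will do. *)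
Lemma perm_mean_perm_stat : perm_mean perm_stat = 0.
Proof.
pose m := \sum_i \sum_j `|a i j|.
have am i j : `|a i j| <= m.
  rewrite /m (bigD1 i)//= (bigD1 j)//= -addrA lerDl addr_ge0// sumr_ge0//.
  by move=> k _; rewrite sumr_ge0.
apply/le_anti/andP; split.
  have := @perm_stat_zero_bias m (fun=> 1) (fun=> 0) am.
  rewrite /perm_mean big1_eq mulr0 (eq_bigr perm_stat); last by move=> s _; rewrite mulr1.
  by apply=> w x y _ _; rewrite subrr !mulr0.
have := @perm_stat_zero_bias m (fun=> -1) (fun=> 0) am.
rewrite /perm_mean big1_eq mulr0 (eq_bigr (fun s => - perm_stat s)); last first.
  by move=> s _; rewrite mulrN1.
rewrite sumrN mulrN oppr_le0.
by apply=> w x y _ _; rewrite subrr !mulr0.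
Qed.

Lemma perm_mean_cst (c : R) : perm_mean (fun=> c) = c.
Proof.
by rewrite /perm_mean sumr_const card_Sn -[c *+ _]mulr_natl mulKf// pnatr_eq0 -lt0n fact_gt0.
Qed.

(** The identity as test function has difference quotient [1], so [U = 1] is allowed. *)
Lemma perm_mean_perm_stat_sqr m : (forall i j, `|a i j| <= m) ->
  perm_mean (fun s => perm_stat s ^+ 2) <= 1.
Proof.
move=> am; rewrite -[leRHS]perm_mean_cst.
apply: (@perm_stat_zero_bias m id (fun=> 1)) => // w x y _ _.
by rewrite mulr1 expr2.
Qed.

Lemma perm_meanD (X Y : 'S_N -> R) :
  perm_mean (fun s => X s + Y s) = perm_mean X + perm_mean Y.
Proof. by rewrite /perm_mean big_split/= mulrDr. Qed.

Lemma perm_meanZ (c : R) (X : 'S_N -> R) :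
  perm_mean (fun s => c * X s) = c * perm_mean X.
Proof. by rewrite /perm_mean -mulr_sumr mulrCA. Qed.

End PermutationStatistic.

(** * Normal approximation of a doubly centred permutation statistic *)

Section PermutationBerryEsseen.
Variable R : realType.

(** The factor [12] comes from [d = 12 * m], the term [2 * (stein_bound R + 3)] from the remainder
    with [E[1 + W^2] <= 2], and the last [1] from the Lipschitz constant of [Phi]. *)
Definition berry_esseen_cst : R := 12 * (2 * (stein_bound R + 3) + 1).

Lemma berry_esseen_cst_gt0 : 0 < berry_esseen_cst.
Proof. by rewrite /berry_esseen_cst; have := stein_bound_gt0 R; lra. Qed.

Variables (N : nat) (a : 'I_N -> 'I_N -> R) (m : R).
Hypothesis row0 : forall i, \sum_j a i j = 0.
Hypothesis col0 : forall j, \sum_i a i j = 0.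
Hypothesis var1 : \sum_i \sum_j a i j ^+ 2 = (N - 1)%:R.
Hypothesis N_ge2 : (2 <= N)%N.
Hypothesis am : forall i j, `|a i j| <= m.

Let W := perm_stat a.
Let P (t : R) := perm_mean (fun s => (W s <= t)%R%:R : R).

Let P01 t : 0 <= P t <= 1.
Proof.
rewrite /P; apply/andP; split.
  by rewrite mulr_ge0 ?invr_ge0// sumr_ge0.
rewrite -[leRHS](@perm_mean_cst R N) ler_wpM2l ?invr_ge0//.
by apply: ler_sum => s _; rewrite lern1 leq_b1.
Qed.

Let remainder d := perm_mean (fun s => (stein_bound R + 3) * (1 + W s ^+ 2) * d).

Let remainder_le d : 0 <= d -> remainder d <= 2 * (stein_bound R + 3) * d.
Proof.
move=> d0; rewrite /remainder.
have -> : perm_mean (fun s => (stein_bound R + 3) * (1 + W s ^+ 2) * d) =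
    (stein_bound R + 3) * d * (1 + perm_mean (fun s => W s ^+ 2)).
  rewrite -[X in _ * (X + _)](@perm_mean_cst R N 1) -perm_meanD -perm_meanZ.
  by congr (_ * _); apply: eq_bigr => s _; ring.
have := perm_mean_perm_stat_sqr row0 col0 var1 N_ge2 am; rewrite -/W => W2.
have K0 : 0 <= (stein_bound R + 3) * d.
  by rewrite mulr_ge0//; have := stein_bound_gt0 R; lra.
have : (stein_bound R + 3) * d * (1 + perm_mean (fun s => W s ^+ 2)) <=
  (stein_bound R + 3) * d * 2 by rewrite ler_wpM2l//; lra.
by lra.
Qed.

Lemma perm_stat_berry_esseen t : `|P t - Phi t| <= berry_esseen_cst * m.
Proof.
have i0 : 'I_N by exact: Ordinal (ltnW N_ge2).
have m0 : 0 <= m := le_trans (normr_ge0 _) (am i0 i0).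
have sb := stein_bound_gt0 R.
have /andP[P0 P1] := P01 t; have Ph0 := Phi_ge0 t; have Ph1 := Phi_le1 t.
set d := 12 * m; have d0 : 0 <= d by rewrite mulr_ge0.
(* For [d > 1] the right-hand side exceeds [1]; the estimates on the Stein solution assume
   [d <= 1]. *)
have [d1|d1] := leP d 1; last first.
  have sd : 0 <= stein_bound R * d by rewrite mulr_ge0// ltW.
  have -> : berry_esseen_cst * m = (2 * (stein_bound R + 3) + 1) * d.
    by rewrite /berry_esseen_cst /d; ring.
  by rewrite ler_norml; apply/andP; split; lra.
have d01 : 0 <= d <= 1 by apply/andP.
have rem := remainder_le d0.
(* With the Stein solution at [t - d], the upper indicator of [stein_sol_increment] is exactly
   [W <= t], and [E[W f W]] cancels from both sides. *)
have lower : Phi (t - d) - 2 * (stein_bound R + 3) * d <= P t.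
  pose f := stein_sol (t - d).
  have := @perm_stat_zero_bias R N a row0 col0 var1 N_ge2 m f
    (fun w => w * f w + (stein_bound R + 3) * (1 + w ^+ 2) * d
              + ((w <= t)%R%:R - Phi (t - d))) am.
  rewrite -/W !perm_meanD perm_mean_cst -/(P t) -/(remainder d).
  move=> H; have {H} : perm_mean (fun s => W s * f (W s)) <=
    perm_mean (fun s => W s * f (W s)) + remainder d + (P t - Phi (t - d)).
    apply: H => w x y xw yw.
    have /andP[_] := @stein_sol_increment R (t - d) w x y d d01 xw yw.
    rewrite subrK -/f; set L := _ * d; set e := (_ <= t)%R%:R; lra.
  by lra.
(* Dually, the solution at [t + d] makes the lower indicator equal to [W <= t]; the test function is
   negated to turn this lower bound into an upper one. *)
have upper : P t <= Phi (t + d) + 2 * (stein_bound R + 3) * d.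
  pose f := stein_sol (t + d).
  have := @perm_stat_zero_bias R N a row0 col0 var1 N_ge2 m (fun x => -1 * f x)
    (fun w => -1 * (w * f w) + (stein_bound R + 3) * (1 + w ^+ 2) * d
              + (-1 * (w <= t)%R%:R + Phi (t + d))) am.
  rewrite -/W !perm_meanD perm_mean_cst !perm_meanZ -/(P t) -/(remainder d).
  rewrite (_ : perm_mean (fun s => W s * (-1 * f (W s))) =
    -1 * perm_mean (fun s => W s * f (W s))); last first.
    by rewrite -perm_meanZ; congr (_ * _); apply: eq_bigr => s _; ring.
  move=> H; have {H} : -1 * perm_mean (fun s => W s * f (W s)) <=
    -1 * perm_mean (fun s => W s * f (W s)) + remainder d + (-1 * P t + Phi (t + d)).
    apply: H => w x y xw yw.
    have /andP[+ _] := @stein_sol_increment R (t + d) w x y d d01 xw yw.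
    rewrite addrK -/f; set L := _ * d; set e := (_ <= t)%R%:R; lra.
  by lra.
have := @Phi_lipschitz R (t - d) t; have := @Phi_lipschitz R t (t + d).
rewrite gerBl lerDl d0 => /(_ isT) U1 /(_ isT) U2.
rewrite ler_norml /berry_esseen_cst; apply/andP; split; move: lower upper U1 U2; rewrite /d; lra.
Qed.

End PermutationBerryEsseen.

(** * Quadratic forms *)

Section QuadraticForms.
Variable R : realType.

Definition bform n (A : 'M[R]_n) (x y : 'cV[R]_n) : R := (x^T *m A *m y) 0 0.

Lemma mx11_tr (A : 'M[R]_1) : A^T 0 0 = A 0 0. Proof. by rewrite mxE. Qed.

Lemma bformC n (A : 'M[R]_n) x y : sym_mx A -> bform A x y = bform A y x.
Proof.
by move=> As; rewrite /bform -mx11_tr !trmx_mul trmxK As mulmxA.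
Qed.

Lemma bform1E n (x : 'cV[R]_n) : bform 1%:M x x = \sum_k x k 0 ^+ 2.
Proof.
by rewrite /bform mulmx1 mxE; apply: eq_bigr => k _; rewrite mxE expr2.
Qed.

Lemma bform1_norm2 n (x : 'cV[R]_n) : bform 1%:M x x = norm2 x ^+ 2.
Proof. by rewrite bform1E sqr_sqrtr// sumr_ge0// => k _; exact: sqr_ge0. Qed.

Lemma norm2_ge0 n (x : 'cV[R]_n) : 0 <= norm2 x.
Proof. exact: sqrtr_ge0. Qed.

Lemma psd1 n : psd (1%:M : 'M[R]_n).
Proof. by move=> x; rewrite -/(bform _ _ _) bform1_norm2 sqr_ge0. Qed.

Lemma bform_CS n (A : 'M[R]_n) x y : sym_mx A -> psd A ->
  bform A x y ^+ 2 <= bform A x x * bform A y y.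
Proof.
move=> As Ap.
have poly t : 0 <= bform A x x + 2 * t * bform A x y + t ^+ 2 * bform A y y.
  have := Ap (x + t *: y).
  suff -> : ((x + t *: y)^T *m A *m (x + t *: y)) 0 0 =
    bform A x x + t * bform A x y + t * bform A y x + t ^+ 2 * bform A y y.
    by rewrite (bformC y x As); lra.
  have -> : (x + t *: y)^T = x^T + t *: y^T by apply/matrixP => i j; rewrite !mxE.
  rewrite /bform !mulmxDl !mulmxDr -!scalemxAl -!scalemxAr scalerA.
  by rewrite !mxE; ring.
set p := bform A x x; set q := bform A y y; set r := bform A x y.
have p0 : 0 <= p by exact: Ap.
have : 0 <= q by exact: Ap.
rewrite le_eqVlt => /predU1P[q0|q0].
  have [->|r0] := eqVneq r 0; first by rewrite expr0n mulr_ge0// -q0.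
  (* With [q = 0] the polynomial is affine of slope [2 * r]; at this point a nonzero [r] would give
     it the value [-1]. *)
  have := poly (- (p + 1) / (2 * r)); rewrite -/p -/q -/r -q0.
  have -> : p + 2 * (- (p + 1) / (2 * r)) * r + (- (p + 1) / (2 * r)) ^+ 2 * 0 = -1.
    by field.
  by rewrite lerNr oppr0 ler10.
have := poly (- r / q); rewrite -/p -/q -/r.
have -> : p + 2 * (- r / q) * r + (- r / q) ^+ 2 * q = (p * q - r ^+ 2) / q.
  by field; rewrite gt_eqF.
by rewrite pmulr_lge0 ?invr_gt0// subr_ge0.
Qed.

Lemma dot_CS n (x y : 'cV[R]_n) : `|(x^T *m y) 0 0| <= norm2 x * norm2 y.
Proof.
have := @bform_CS n 1%:M x y (trmx1 _ _) (@psd1 n).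
rewrite {1}/bform mulmx1 !bform1_norm2 -exprMn -[X in X <= _]real_normK ?num_real//.
by rewrite ler_pXn2r// nnegrE ?normr_ge0 ?mulr_ge0 ?norm2_ge0.
Qed.

(** Cauchy-Schwarz for the form [S] at [v] and [invmx S *m y]. *)
Lemma bform_inv_CS n (S : 'M[R]_n) (v y : 'cV[R]_n) : S \in unitmx -> sym_mx S ->
  psd S -> (v^T *m y) 0 0 ^+ 2 <= bform S v v * bform (invmx S) y y.
Proof.
move=> Su Ss Sp; have := @bform_CS n S v (invmx S *m y) Ss Sp.
rewrite /bform trmx_mul trmx_inv Ss -!mulmxA !(mulmxA S (invmx S)) mulmxV//.
by rewrite !mul1mx.
Qed.

(** A crude entrywise bound, enough to make the Rayleigh quotients of a matrix bounded above. *)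
Lemma bform_le n (A : 'M[R]_n) (x : 'cV[R]_n) :
  bform A x x <= (\sum_i \sum_j `|A i j|) * norm2 x ^+ 2.
Proof.
rewrite /bform -bform1_norm2 bform1E -mulmxA mxE mulr_suml; apply: ler_sum => i _.
rewrite mxE [X in _ * X]mxE mulr_sumr mulr_suml; apply: ler_sum => j _.
set T := \sum_k _.
have xT k : `|x k 0| ^+ 2 <= T.
  rewrite real_normK ?num_real// /T (bigD1 k)//= lerDl sumr_ge0// => l _.
  exact: sqr_ge0.
apply: (le_trans (ler_norm _)); rewrite !normrM mulrCA ler_wpM2l//.
have := xT i; have := xT j; have := sqr_ge0 (`|x i 0| - `|x j 0|); nra.
Qed.

Lemma eigenvalue_unitmx n (A : 'M[R]_n) (c : R) :
  eigenvalue A c = (A - c%:M \notin unitmx).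
Proof. by rewrite /eigenvalue /eigenspace kermx_eq0 row_free_unit. Qed.

Lemma norm2_eq0 n (x : 'cV[R]_n) : norm2 x = 0 -> x = 0.
Proof.
move=> x0; apply/matrixP => i j; rewrite ord1 mxE.
have : bform 1%:M x x = 0 by rewrite bform1_norm2 x0 expr0n.
rewrite bform1E => /psumr_eq0P => /(_ (fun k _ => sqr_ge0 _)) /(_ i isT).
by move=> /eqP; rewrite sqrf_eq0 => /eqP.
Qed.

(* The supremum [mu] of the Rayleigh quotient is an eigenvalue: otherwise
   Cauchy-Schwarz for the form [mu - A] bounds it away from [0] on the sphere. *)
Lemma rayleigh_sup_eigenvalue n (A : 'M[R]_n) (b : 'cV[R]_n) : sym_mx A -> norm2 b = 1 ->
  exists mu, [/\ eigenvalue A mu, bform A b b <= mu &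
    forall x, bform A x x <= mu * norm2 x ^+ 2].
Proof.
move=> As b1.
pose E : set R := [set r | exists2 x, norm2 x = 1 & r = bform A x x]%classic.
have Eb : E (bform A b b) by exists b.
have supE : has_sup E.
  split; first by exists (bform A b b).
  exists (\sum_i \sum_j `|A i j|) => _ [x x1 ->].
  by have := bform_le A x; rewrite x1 expr1n mulr1.
pose mu := sup E; exists mu.
have ub x : norm2 x = 1 -> bform A x x <= mu.
  by move=> x1; apply: sup_upper_bound => //; exists x.
have ray x : bform A x x <= mu * norm2 x ^+ 2.
  have [x0|x0] := eqVneq (norm2 x) 0.
    by rewrite x0 (norm2_eq0 x0) /bform mulmx0 mxE expr0n mulr0.
  pose y := (norm2 x)^-1 *: x.
  have yE (B : 'M[R]_n) : bform B y y = (norm2 x)^-2 * bform B x x.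
    rewrite /bform; have -> : y^T = (norm2 x)^-1 *: x^T by apply/matrixP => i j; rewrite !mxE.
    by rewrite /y -!scalemxAl -!scalemxAr scalerA mxE -expr2 exprVn.
  have y1 : norm2 y = 1.
    apply/eqP; rewrite -(@eqrXn2 _ 2)// ?norm2_ge0// -bform1_norm2 yE bform1_norm2.
    by rewrite mulVf ?expf_neq0// expr1n.
  have := ub y y1; rewrite yE mulrC ler_pdivrMr//.
  by rewrite exprn_gt0// lt_def x0 norm2_ge0.
split=> //; last exact: ub.
rewrite eigenvalue_unitmx; apply/negP => Bu.
pose B := mu%:M - A.
have BE : B = - (A - mu%:M) by rewrite opprB.
have {}Bu : B \in unitmx by rewrite BE -scaleN1r unitmxZ ?unitrN1.
have bB x : bform B x x = mu * norm2 x ^+ 2 - bform A x x.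
  rewrite -bform1_norm2 /bform /B mulmxBr mulmxBl mxE [X in _ + X]mxE.
  by rewrite mul_mx_scalar -scalemxAl [X in X - _]mxE mulmx1.
have Bs : sym_mx B by rewrite /sym_mx /B linearB/= tr_scalar_mx As.
have Bp : psd B by move=> x; rewrite -/(bform _ _ _) bB subr_ge0.
pose K := 1 + \sum_i \sum_j `|invmx B i j|.
have K0 : 0 < K by rewrite ltr_pwDl// sumr_ge0// => i _; rewrite sumr_ge0.
(* On the sphere, [1 = (x^T x)^2] is at most [bform B x x * bform (invmx B) x x], whose second
   factor is at most [K]. *)
have gap x : norm2 x = 1 -> bform A x x <= mu - K^-1.
  move=> x1; have := bform_inv_CS x x Bu Bs Bp.
  rewrite -[X in (x^T *m X) 0 0](mul1mx x) mulmxA -/(bform _ _ _) bform1_norm2 x1 !expr1n.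
  have BV : bform (invmx B) x x <= K.
    by have := bform_le (invmx B) x; rewrite x1 expr1n mulr1 /K; lra.
  have Bx : 0 <= bform B x x by exact: Bp.
  have -> : bform A x x = mu - bform B x x by rewrite bB x1 expr1n mulr1; ring.
  move=> h; rewrite lerD2l lerN2 -[leLHS]mul1r ler_pdivrMr//.
  by apply: le_trans h _; rewrite ler_wpM2l.
have : mu <= mu - K^-1.
  by apply: ge_sup; [exists (bform A b b) | move=> _ [x x1 ->]; exact: gap].
by rewrite lerDl oppr_ge0 leNgt invr_gt0 K0.
Qed.

(** The largest eigenvalue [mu] of the inverse dominates its form on the unit sphere, and [mu^-1] is
    the smallest eigenvalue of [V]. The unit vector [b] rules out dimension [0]. *)
Lemma rho_min_bform n (V : 'M[R]_n) (b : 'cV[R]_n) : V \in unitmx ->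
    sym_mx (invmx V) -> pd (invmx V) -> norm2 b = 1 ->
  0 < rho_min V /\ bform (invmx V) b b <= (rho_min V)^-1.
Proof.
move=> Vu As Ap b1; set A := invmx V.
have [mu [Amu bmu ray]] := rayleigh_sup_eigenvalue As b1.
have mu0 : 0 < mu.
  apply: lt_le_trans bmu; apply: Ap; apply/eqP => b0.
  move: b1; rewrite b0 /norm2 big1 ?sqrtr0 => [/esym/eqP|k _]; first by rewrite oner_eq0.
  by rewrite mxE expr0n.
suff -> : rho_min V = mu^-1 by rewrite invr_gt0 invrK.
have Vmu : eigenvalue V mu^-1.
  move/eigenvalueP : Amu => [v vA v0]; apply/eigenvalueP; exists v => //.
  rewrite -{2}(mulmxKV Vu v) -/A vA -scalemxAl scalerA mulVf ?scale1r//.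
  by rewrite gt_eqF.
(* For an eigenvector [v] of [V] at [c], [|v|^2] equals [c] times the form of the inverse at [v],
   hence is at most [c * mu * |v|^2]. *)
have lb c : eigenvalue V c -> mu^-1 <= c.
  move=> /eigenvalueP[v vV v0].
  have vA : v = c *: (v *m A) by rewrite scalemxAl -vV mulmxK.
  have xE : norm2 v^T ^+ 2 = c * bform A v^T v^T.
    rewrite -bform1_norm2 /bform trmxK mulmx1 {1}vA -scalemxAl mxE//.
  have x0 : 0 < norm2 v^T ^+ 2.
    rewrite exprn_gt0// lt_def norm2_ge0 andbT; apply/eqP => /norm2_eq0 /eqP.
    by rewrite trmx_eq0 (negbTE v0).
  have Ax0 : 0 < bform A v^T v^T by apply: Ap; rewrite trmx_eq0.
  have c0 : 0 < c by move: x0; rewrite xE pmulr_lgt0.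
  rewrite -(ler_pM2l mu0) mulfV ?gt_eqF// -(ler_pM2r x0) mul1r {1}xE.
  by rewrite (mulrC mu) -mulrA ler_wpM2l ?(ltW c0).
apply/le_anti/andP; split.
  by apply: ge_inf => //; exists mu^-1 => c; exact: lb.
by apply: lb_le_inf; [exists mu^-1 | move=> c; exact: lb].
Qed.

End QuadraticForms.

(** * Complete randomization *)

Section CompleteRandomization.
Variables (R : realType) (N Q : nat) (Nq : 'I_Q -> nat).
Implicit Types z : {ffun 'I_N -> 'I_Q}.

Lemma admissibleP z : reflect (forall q, #|[pred i | z i == q]| = Nq q)
  (z \in admissible N Nq).
Proof.
have cardE q : #|[set i | z i == q]%classic| = #|[pred i | z i == q]|.
  by apply: eq_card => i; apply/idP/idP => [/set_mem|h]; last exact/mem_set.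
rewrite inE; apply: (iffP forallP) => h q.
  by rewrite -cardE; apply/eqP/h.
by apply/eqP; rewrite cardE.
Qed.

Lemma count_mem_ffun z q :
  count_mem q [tuple z i | i < N] = #|[pred i | z i == q]|.
Proof. by rewrite cardE size_filter /= count_map enumT. Qed.

(** The witness lists [Nq q] copies of each label [q] one after the other. *)
Lemma admissible_neq0 : (\sum_(q < Q) Nq q)%N = N -> exists z, z \in admissible N Nq.
Proof.
move=> sumNq.
pose s := flatten [seq nseq (Nq q) q | q <- enum 'I_Q].
have sizes : size s == N.
  rewrite size_flatten /shape -map_comp sumnE big_map big_enum/= -[X in _ == X]sumNq.
  by apply/eqP; apply: eq_bigr => q _; rewrite size_nseq.
pose z : {ffun 'I_N -> 'I_Q} := [ffun i => tnth (Tuple sizes) i].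
exists z; apply/admissibleP => q.
rewrite -count_mem_ffun.
have -> : [tuple z i | i < N] = Tuple sizes.
  by apply: eq_from_tnth => i; rewrite tnth_mktuple ffunE.
rewrite /= /s count_flatten -map_comp sumnE big_map big_enum/= (bigD1 q)//=.
rewrite count_nseq/= eqxx mul1n big1 ?addn0// => q' qq'.
by rewrite count_nseq/= (negbTE qq').
Qed.

(** Equal label counts make the two label tuples permutations of each other, so relabelling acts
    transitively. *)
Lemma admissible_perm z0 z : z0 \in admissible N Nq -> z \in admissible N Nq ->
  exists p : 'S_N, forall i, z i = z0 (p i).
Proof.
move=> /admissibleP z0P /admissibleP zP.
have : perm_eq [tuple z i | i < N] [tuple z0 i | i < N].
  by apply/allP => q _ /=; rewrite !count_mem_ffun z0P zP.
move=> /tuple_permP[p E]; exists p => i.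
have : tnth [tuple z i | i < N] i = tnth [tuple tnth [tuple z0 i | i < N] (p i) | i < N] i.
  by congr tnth; exact: val_inj.
by rewrite !tnth_mktuple.
Qed.

Definition relabel z (s : 'S_N) : {ffun 'I_N -> 'I_Q} := [ffun i => z (s i)].

Lemma relabel_admissible z s : z \in admissible N Nq -> relabel z s \in admissible N Nq.
Proof.
move=> /admissibleP zP; apply/admissibleP => q; rewrite -(zP q).
rewrite -[RHS](fintype.card_image (@perm_inj _ (s^-1)%g)); apply: eq_card => i.
rewrite inE ffunE; apply/idP/fintype.imageP => [h|[j + ->]]; last by rewrite inE permKV.
by exists (s i); rewrite ?inE// permK.
Qed.

(** A uniform permutation of the units of a fixed assignment gives a uniform admissible assignment:
    by transitivity, all fibres of [relabel z0] have the size [K] of the stabiliser of [z0]. *)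
Lemma sum_admissible z0 (X : {ffun 'I_N -> 'I_Q} -> R) : z0 \in admissible N Nq ->
  (#|admissible N Nq|%:R)^-1 * \sum_(z in admissible N Nq) X z
  = perm_mean (fun s => X (relabel z0 s)).
Proof.
move=> z0P.
pose K := #|[set s : 'S_N | relabel z0 s == z0]|.
have fibre z : z \in admissible N Nq -> #|[set s : 'S_N | relabel z0 s == z]| = K.
  move=> zP; have [p pE] := admissible_perm z0P zP.
  rewrite /K -[RHS](card_imset _ (mulgI p)); apply: eq_card => s.
  rewrite inE; apply/eqP/imsetP => [E|[u]].
    exists (p^-1 * s)%g; last by rewrite mulKVg.
    rewrite inE; apply/eqP/ffunP => i; rewrite ffunE permM.
    by have /ffunP/(_ (p^-1 i)%g) := E; rewrite ffunE pE permKV.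
  rewrite inE => /eqP uE ->; apply/ffunP => i; rewrite ffunE permM pE.
  by have /ffunP/(_ (p i)) := uE; rewrite ffunE.
have sumE (Y : {ffun 'I_N -> 'I_Q} -> R) :
    \sum_(s : 'S_N) Y (relabel z0 s) = K%:R * \sum_(z in admissible N Nq) Y z.
  rewrite (partition_big (relabel z0) (mem (admissible N Nq)))/=; last first.
    by move=> s _; exact: relabel_admissible.
  rewrite mulr_sumr; apply: eq_bigr => z zP.
  rewrite (eq_bigr (fun=> Y z)); last by move=> s /eqP ->.
  rewrite -(fibre z zP) -sum1_card natr_sum mulr_suml.
  by apply: eq_big => [s|s _]; rewrite ?inE ?mul1r.
(* The fibre count for the constant function [1] gives the normalisation. *)
have KE : N`!%:R = K%:R * #|admissible N Nq|%:R :> R.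
  have := sumE (fun=> 1); rewrite !sumr_const card_Sn => ->//.
have A0 : #|admissible N Nq|%:R != 0 :> R.
  by rewrite pnatr_eq0 -lt0n; apply/card_gt0P; exists z0.
have K0 : K%:R != 0 :> R.
  rewrite pnatr_eq0 -lt0n; apply/card_gt0P; exists 1%g.
  by rewrite inE; apply/eqP/ffunP => i; rewrite ffunE perm1.
by rewrite /perm_mean sumE KE; field; rewrite A0.
Qed.

Lemma sum_label z (g : 'I_Q -> R) : z \in admissible N Nq ->
  \sum_i g (z i) = \sum_q (Nq q)%:R * g q.
Proof.
move=> /admissibleP zP.
rewrite (partition_big z predT)//=; apply: eq_bigr => q _.
rewrite (eq_bigr (fun=> g q)); last by move=> i /eqP ->.
rewrite -(zP q) -sum1_card natr_sum mulr_suml.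
by apply: eq_big => [s|s _]; rewrite ?inE ?mul1r.
Qed.

Variable c : 'I_N -> 'I_Q -> R.
Let r i := N%:R^-1 * \sum_q (Nq q)%:R * c i q.
Variable M : R.
Hypothesis sumNq : (\sum_(q < Q) Nq q)%N = N.
Hypothesis N_ge2 : (2 <= N)%N.
Hypothesis col0 : forall q, \sum_i c i q = 0.
Hypothesis var1 : \sum_i \sum_q (Nq q)%:R * c i q ^+ 2
  - N%:R^-1 * \sum_i (\sum_q (Nq q)%:R * c i q) ^+ 2 = (N - 1)%:R.
Hypothesis cM : forall i q, `|c i q| <= M.

Let N0 : N%:R != 0 :> R.
Proof. by rewrite pnatr_eq0 -lt0n (leq_trans _ N_ge2). Qed.

Let Nr i : \sum_q (Nq q)%:R * c i q = N%:R * r i.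
Proof. by rewrite mulVKf. Qed.

Let sum_r : \sum_i r i = 0.
Proof.
rewrite -mulr_sumr exchange_big/= big1 ?mulr0// => q _.
by rewrite -mulr_sumr col0 mulr0.
Qed.

Let sumNqR : \sum_q (Nq q)%:R = N%:R :> R.
Proof. by rewrite -natr_sum sumNq. Qed.

Section Array.
Variable z0 : {ffun 'I_N -> 'I_Q}.
Hypothesis z0P : z0 \in admissible N Nq.

(** Here [r i] is the mean of row [i], the same for every admissible [z0]. Subtracting it centres
    the rows; since the [r i] sum to [0], columns stay centred and the statistic is unchanged. *)
Let a i j := c i (z0 j) - r i.

Let array_row0 i : \sum_j a i j = 0.
Proof.
by rewrite sumrB sumr_const card_ord (sum_label (c i) z0P) Nr mulr_natl subrr.
Qed.

Let array_col0 j : \sum_i a i j = 0.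
Proof. by rewrite sumrB col0 sum_r subrr. Qed.

Let array_var1 : \sum_i \sum_j a i j ^+ 2 = (N - 1)%:R.
Proof.
rewrite -var1 mulr_sumr -sumrB; apply: eq_bigr => i _.
rewrite (sum_label (fun q => (c i q - r i) ^+ 2) z0P).
transitivity (\sum_q ((Nq q)%:R * c i q ^+ 2 - 2 * r i * ((Nq q)%:R * c i q)
   + r i ^+ 2 * (Nq q)%:R)); first by apply: eq_bigr => q _; ring.
by rewrite big_split/= sumrB -!mulr_sumr sumNqR Nr; field.
Qed.

(** The row mean is a weighted average of entries bounded by [M], whence the factor [2]. *)
Let array_le i j : `|a i j| <= 2 * M.
Proof.
apply: (le_trans (ler_normB _ _)); have := cM i (z0 j).
suff : `|r i| <= M by lra.
rewrite /r normrM normfV normr_nat mulrC ler_pdivrMr; last by rewrite lt_def N0 ler0n.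
apply: (le_trans (ler_norm_sum _ _ _)); rewrite -sumNqR mulr_sumr.
by apply: ler_sum => q _; rewrite normrM normr_nat mulrC ler_wpM2r.
Qed.

Let perm_statE s : perm_stat a s = \sum_i c i (relabel z0 s i).
Proof.
rewrite /perm_stat /a sumrB sum_r subr0.
by apply: eq_bigr => i _; rewrite ffunE.
Qed.

Lemma array_mean : \sum_(z in admissible N Nq) \sum_i c i (z i) = 0.
Proof.
have := sum_admissible (fun z => \sum_i c i (z i)) z0P.
have -> : perm_mean (fun s => \sum_i c i (relabel z0 s i)) = perm_mean (perm_stat a).
  by congr (_ * _); apply: eq_bigr => s _; rewrite perm_statE.
rewrite (perm_mean_perm_stat array_row0 array_col0 array_var1 N_ge2) => /eqP.
rewrite mulf_eq0 invr_eq0 pnatr_eq0 => /orP[|/eqP//].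
by move/eqP/card0_eq/(_ z0); rewrite z0P.
Qed.

Lemma array_berry_esseen t :
  `|prob_cr R Nq (fun z => \sum_i c i (z i) <= t) - Phi t|
    <= berry_esseen_cst R * (2 * M).
Proof.
have := perm_stat_berry_esseen array_row0 array_col0 array_var1 N_ge2 array_le t.
suff -> : prob_cr R Nq (fun z => \sum_i c i (z i) <= t) =
  perm_mean (fun s => (perm_stat a s <= t)%R%:R) by [].
transitivity (perm_mean (fun s => ((\sum_i c i (relabel z0 s i) <= t)%R%:R : R))).
  rewrite -(sum_admissible (fun z => (\sum_i c i (z i) <= t)%R%:R) z0P).
  rewrite /prob_cr mulrC; congr (_ * _).
  rewrite -sum1_card natr_sum big_mkcond [RHS]big_mkcond; apply: eq_bigr => z _.
  by rewrite finset.in_set; case: (z \in admissible N Nq) => //=; case: leP.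
by congr (_ * _); apply: eq_bigr => s _; rewrite perm_statE.
Qed.

End Array.

Lemma mean_label_sum : \sum_(z in admissible N Nq) \sum_i c i (z i) = 0.
Proof. by have [z0 z0P] := admissible_neq0 sumNq; exact: array_mean z0P. Qed.

Lemma label_sum_berry_esseen t :
  `|prob_cr R Nq (fun z => \sum_i c i (z i) <= t) - Phi t|
    <= berry_esseen_cst R * (2 * M).
Proof. by have [z0 z0P] := admissible_neq0 sumNq; exact: array_berry_esseen z0P t. Qed.

End CompleteRandomization.

(** * Linear contrasts *)

Lemma row_quad_sum (R : realType) (I : finType) n (x : 'rV[R]_n) (v : I -> 'cV[R]_n) :
  (x *m (\sum_i v i *m (v i)^T) *m x^T) 0 0 = \sum_i ((x *m v i) 0 0) ^+ 2.
Proof.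
rewrite mulmx_sumr mulmx_suml summxE; apply: eq_bigr => i _.
by rewrite mulmxA -mulmxA -trmx_mul mxE big_ord1 [in X in _ * X]mxE expr2.
Qed.

Section LinearContrast.
Variables (R : realType) (N Q p H : nat) (Nq : 'I_Q -> nat).
Variables (Y : 'I_N -> 'I_Q -> 'cV[R]_p) (F : 'I_Q -> 'M[R]_(H, p)).
Variable u : 'rV[R]_H.

(** The centred contribution of unit [i] in arm [q] to the estimator along [u], written so that with
    [u = b^T *m W] it is the quantity in the bound of (i). *)
Definition contrast i q : R :=
  (u *m (((Nq q)%:R)^-1 *: (F q *m Ybrev Y i q))) 0 0.

Let raw i q : R := (u *m F q *m Ybrev Y i q) 0 0.

Let contrastE i q : contrast i q = (Nq q)%:R^-1 * raw i q.
Proof. by rewrite /contrast -scalemxAr mxE mulmxA. Qed.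

Hypothesis Nq_gt0 : forall q, (0 < Nq q)%N.
Hypothesis N_ge2 : (2 <= N)%N.

Let N0 : N%:R != 0 :> R.
Proof. by rewrite pnatr_eq0 -lt0n (leq_trans _ N_ge2). Qed.

Let N10 : (N - 1)%:R != 0 :> R.
Proof. by rewrite pnatr_eq0 -lt0n subn_gt0. Qed.

Let Nq0 q : (Nq q)%:R != 0 :> R.
Proof. by rewrite pnatr_eq0 -lt0n. Qed.

Lemma sum_Ybrev q : \sum_i Ybrev Y i q = 0.
Proof.
rewrite sumrB sumr_const card_ord -[X in _ - X]scaler_nat /Ybar scalerA.
by rewrite mulfV// scale1r subrr.
Qed.

Lemma sum_contrast q : \sum_i contrast i q = 0.
Proof.
under eq_bigr => i _ do rewrite contrastE.
by rewrite -mulr_sumr /raw -summxE -mulmx_sumr sum_Ybrev mulmx0 mxE mulr0.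
Qed.

Lemma gamma_center i : gamma_i Y F i - gammabar Y F = \sum_q F q *m Ybrev Y i q.
Proof.
rewrite /gammabar /gamma_i exchange_big/= scaler_sumr -sumrB; apply: eq_bigr => q _.
by rewrite -mulmx_sumr scalemxAr -mulmxBr.
Qed.

Lemma quad_Scov q : (u *m F q *m Scov Y q q *m (u *m F q)^T) 0 0
  = (N - 1)%:R^-1 * \sum_i raw i q ^+ 2.
Proof. by rewrite /Scov -scalemxAr -scalemxAl mxE row_quad_sum. Qed.

(** This identifies the variance along [u] with the normalisation that the label-sum theorem assumes
    of its coefficients. *)
Lemma quad_Vgamma : (N - 1)%:R * (u *m Vgamma Nq Y F *m u^T) 0 0 =
  \sum_i \sum_q (Nq q)%:R * contrast i q ^+ 2
  - N%:R^-1 * \sum_i (\sum_q (Nq q)%:R * contrast i q) ^+ 2.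
Proof.
rewrite /Vgamma mulmxBr mulmxBl mxE [X in _ + X]mxE mulrBr; congr (_ - _).
  rewrite mulmx_sumr mulmx_suml summxE mulr_sumr exchange_big/=; apply: eq_bigr => q _.
  rewrite -scalemxAr -scalemxAl mxE !mulmxA -[_ *m u^T]mulmxA -trmx_mul quad_Scov.
  rewrite mulrCA mulVKf// mulr_sumr; apply: eq_bigr => i _; rewrite contrastE.
  by field.
rewrite -scalemxAr -scalemxAl mxE /S_F -scalemxAr -scalemxAl mxE row_quad_sum.
rewrite mulrCA mulVKf//; congr (_ * _); apply: eq_bigr => i _.
rewrite gamma_center mulmx_sumr summxE; congr (_ ^+ 2); apply: eq_bigr => q _.
by rewrite contrastE mulVKf// mulmxA.
Qed.

(** Splitting each outcome into [Ybrev] and [Ybar] leaves a term free of [z], because arm [q] always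
    holds [Nq q] units. *)
Lemma gammahat_contrast z : z \in admissible N Nq ->
  (u *m gammahat Nq Y F z) 0 0 =
    \sum_i contrast i (z i) + \sum_q (u *m F q *m Ybar Y q) 0 0.
Proof.
move=> /admissibleP zP.
rewrite (partition_big z predT)//= -big_split/= mulmx_sumr summxE; apply: eq_bigr => q _.
rewrite (eq_bigr (fun i => contrast i q)); last by move=> i /eqP ->.
rewrite /Yhat -[in LHS]scalemxAr -[in LHS]scalemxAr mxE mulmxA.
rewrite (eq_bigr (fun i => Ybrev Y i q + Ybar Y q)); last first.
  by move=> i _; rewrite subrK.
rewrite big_split/= mulmxDr mxE mulrDr; congr (_ + _).
  rewrite mulmx_sumr summxE mulr_sumr; apply: eq_bigr => i _.
  by rewrite contrastE.
rewrite sumr_const zP; move: (Ybar Y q) => yb.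
by rewrite -[yb *+ _]scaler_nat -scalemxAr mxE mulKf.
Qed.

Lemma centered_gammahat_contrast z : z \in admissible N Nq ->
    \sum_(z in admissible N Nq) \sum_i contrast i (z i) = 0 ->
  (u *m (gammahat Nq Y F z - expect_cr Nq (gammahat Nq Y F))) 0 0 =
  \sum_i contrast i (z i).
Proof.
move=> zP mean0; rewrite mulmxBr mxE [X in _ + X]mxE gammahat_contrast//.
rewrite /expect_cr -scalemxAr mxE mulmx_sumr summxE.
rewrite (eq_bigr _ (fun z zP => gammahat_contrast zP)) big_split/= mean0 add0r.
rewrite sumr_const -[X in _^-1 * X]mulr_natl mulKf ?addrK//.
by rewrite pnatr_eq0 -lt0n; apply/card_gt0P; exists z.
Qed.

End LinearContrast.

Lemma Scov_sym (R : realType) N Q p (Y : 'I_N -> 'I_Q -> 'cV[R]_p) q :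
  sym_mx (Scov Y q q).
Proof.
rewrite /sym_mx /Scov linearZ/= linear_sum/=; congr (_ *: _).
by apply: eq_bigr => i _; rewrite trmx_mul trmxK.
Qed.

Lemma Scov_psd (R : realType) N Q p (Y : 'I_N -> 'I_Q -> 'cV[R]_p) q :
  psd (Scov Y q q).
Proof.
move=> x; have := row_quad_sum x^T (fun i => Ybrev Y i q); rewrite trmxK => quadE.
rewrite /Scov -scalemxAr -scalemxAl mxE quadE mulr_ge0 ?invr_ge0//.
by apply: sumr_ge0 => i _; exact: sqr_ge0.
Qed.

Lemma bigmax2_le (R : realType) (I J : finType) (f g : I -> J -> R) :
  (forall i j, f i j <= g i j) ->
  \big[Num.max/0]_i \big[Num.max/0]_j f i j
    <= \big[Num.max/0]_i \big[Num.max/0]_j g i j.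
Proof.
by move=> fg; apply: le_bigmax2 => i _; apply: le_bigmax2 => j _; exact: fg.
Qed.

Lemma le_bigmax2_cond (R : realType) (I J : finType) (f : I -> J -> R) i j :
  f i j <= \big[Num.max/0]_i \big[Num.max/0]_j f i j.
Proof.
by apply: le_trans (le_bigmax _ _ i); exact: (le_bigmax _ (f i) j).
Qed.

(** Euclidean Cauchy-Schwarz on each column of [M], with the coordinates of [y] bounded by their
    maximum. *)
Lemma norm21_norminf (R : realType) h n (u : 'rV[R]_h) (M : 'M[R]_(h, n)) (y : 'cV[R]_n) :
  `|(u *m M *m y) 0 0| <= norm2 u^T * norm21 M * norminf y.
Proof.
rewrite mxE; apply: (le_trans (ler_norm_sum _ _ _)).
rewrite /norm21 mulr_sumr mulr_suml; apply: ler_sum => k _.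
rewrite normrM; apply: ler_pM => //; last exact: le_bigmax.
have -> : (u *m M) 0 k = ((u^T)^T *m col k M) 0 0.
  by rewrite trmxK !mxE; apply: eq_bigr => j _; rewrite mxE.
exact: dot_CS.
Qed.

(** * The standardized estimator along a unit vector *)

Section Standardized.
Variables (R : realType) (N Q p H : nat) (Nq : 'I_Q -> nat).
Variables (Y : 'I_N -> 'I_Q -> 'cV[R]_p) (F : 'I_Q -> 'M[R]_(H, p)).
Hypothesis Nq_gt0 : forall q, (0 < Nq q)%N.
Hypothesis sumNq : (\sum_(q < Q) Nq q)%N = N.

Let V := Vgamma Nq Y F.
Hypothesis V_unit : V \in unitmx.

Variable W : 'M[R]_H.
Hypotheses (W_sym : sym_mx W) (W_pd : pd W) (WW : W *m W = invmx V).

Variable b : 'cV[R]_H.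
Hypothesis b1 : norm2 b = 1.

Let u := b^T *m W.

(** For [N <= 1] the factor [(N - 1)%:R^-1] is [0] by convention, so [V] vanishes; a zero matrix is
    not invertible in the positive dimension that the unit vector [b] provides. *)
Let N_ge2 : (2 <= N)%N.
Proof.
rewrite leqNgt; apply/negP => N1.
have N10 : (N - 1)%N = 0%N by apply/eqP; rewrite subn_eq0 -ltnS.
have V0 : V = 0.
  rewrite /V /Vgamma /S_F N10 invr0 scale0r scaler0 subr0 big1// => q _.
  by rewrite /Scov N10 invr0 scale0r mulmx0 mul0mx scaler0.
move: b1; rewrite -(mul1mx b) -(mulmxV V_unit) V0 !mul0mx /norm2 big1 => [|k _].
  by rewrite sqrtr0 => /esym/eqP; rewrite oner_eq0.
by rewrite mxE expr0n.
Qed.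

Let u_tr : u^T = W *m b. Proof. by rewrite trmx_mul trmxK W_sym. Qed.

Let bb : (b^T *m b) 0 0 = 1.
Proof. by have := bform1_norm2 b; rewrite /bform mulmx1 b1 expr1n. Qed.

Lemma standardized_var : (u *m V *m u^T) 0 0 = 1.
Proof.
(* From [W *m (W *m V) = 1], since a one-sided inverse of a square matrix is two-sided. *)
have WVW : W *m V *m W = 1%:M by apply: mulmx1C; rewrite mulmxA WW mulVmx.
rewrite u_tr /u -!mulmxA (mulmxA V) (mulmxA W) (mulmxA W V) WVW mul1mx.
exact: bb.
Qed.

Lemma standardized_berry_esseen t :
  `|prob_cr R Nq (fun z => (b^T *m (W *m (gammahat Nq Y F z
      - expect_cr Nq (gammahat Nq Y F)))) 0 0 <= t) - Phi t|
  <= 2 * berry_esseen_cst R *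
     \big[Num.max/0]_(i < N) \big[Num.max/0]_(q < Q) `|contrast Nq Y F u i q|.
Proof.
set c := contrast Nq Y F u; set M := \big[_/_]_i _.
have cM i q : `|c i q| <= M by exact: (le_bigmax2_cond (fun i q => `|c i q|)).
have c0 q : \sum_i c i q = 0 by exact: sum_contrast.
have cvar : \sum_i \sum_q (Nq q)%:R * c i q ^+ 2
  - N%:R^-1 * \sum_i (\sum_q (Nq q)%:R * c i q) ^+ 2 = (N - 1)%:R.
  by rewrite -quad_Vgamma// standardized_var mulr1.
have mean0 := mean_label_sum sumNq N_ge2 c0 cvar.
have := label_sum_berry_esseen sumNq N_ge2 c0 cvar cM t.
rewrite (mulrA (berry_esseen_cst R)) (mulrC (berry_esseen_cst R) 2).
suff -> : prob_cr R Nq (fun z => (b^T *m (W *m (gammahat Nq Y F z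
      - expect_cr Nq (gammahat Nq Y F)))) 0 0 <= t)
    = prob_cr R Nq (fun z => \sum_i c i (z i) <= t) by [].
rewrite /prob_cr; congr (_%:R / _); apply: eq_card => z.
rewrite finset.in_set [RHS]finset.in_set; apply: andb_id2l => zP.
by rewrite mulmxA centered_gammahat_contrast.
Qed.

(** Evaluated at [u], where [V] has form [1], the domination hypothesis bounds the sum over arms by
    [sigmaF ^+ 2], hence each nonnegative summand. Cauchy-Schwarz between [Scov Y q q] and its
    inverse then separates [u] from the outcome. *)
Lemma contrast_le_leverage sigmaF i q : Scov Y q q \in unitmx -> 1 <= sigmaF ->
    psd (sigmaF ^+ 2 *: V
          - \sum_(q < Q) (((Nq q)%:R)^-1 *: (F q *m Scov Y q q *m (F q)^T))) ->
  `|contrast Nq Y F u i q| <= 2 * sigmaF * Num.sqrt (((Nq q)%:R)^-1 *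
     ((Ybrev Y i q)^T *m invmx (Scov Y q q) *m Ybrev Y i q) 0 0).
Proof.
move=> S_unit sF1 S_le.
pose v := (u *m F q)^T; pose y := Ybrev Y i q; pose S := Scov Y q q.
pose n : R := (Nq q)%:R; have n0 : 0 < n by rewrite ltr0n.
have form q' : (u *m ((Nq q')%:R^-1 *: (F q' *m Scov Y q' q' *m (F q')^T)) *m u^T) 0 0
    = (Nq q')%:R^-1 * bform (Scov Y q' q') (u *m F q')^T (u *m F q')^T.
  by rewrite -scalemxAr -scalemxAl mxE /bform trmxK (trmx_mul u (F q')) !mulmxA.
have varS : n^-1 * bform S v v <= sigmaF ^+ 2.
  have := S_le u^T; rewrite trmxK mulmxBr mulmxBl mxE [X in _ + X]mxE.
  rewrite -scalemxAr -scalemxAl mxE standardized_var mulr1.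
  rewrite mulmx_sumr mulmx_suml summxE (eq_bigr _ (fun q _ => form q)) (bigD1 q)//=.
  rewrite subr_ge0; apply: le_trans; rewrite lerDl sumr_ge0// => q' _.
  by rewrite mulr_ge0 ?invr_ge0//; exact: Scov_psd.
have sq : contrast Nq Y F u i q ^+ 2 <= sigmaF ^+ 2 * (n^-1 * bform (invmx S) y y).
  have -> : contrast Nq Y F u i q = n^-1 * (v^T *m y) 0 0.
    by rewrite /contrast -scalemxAr mxE mulmxA trmxK.
  have := bform_inv_CS v y S_unit (Scov_sym Y q) (@Scov_psd _ _ _ _ Y q).
  rewrite -/S exprMn => CS.
  have Sy0 : 0 <= n^-1 * bform (invmx S) y y.
    (* Nonnegativity of the inverse form is read off from that of [S] at [invmx S *m y]. *)
    have -> : bform (invmx S) y y = bform S (invmx S *m y) (invmx S *m y).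
      rewrite /bform trmx_mul trmx_inv (Scov_sym Y q) -/S -!mulmxA.
      by rewrite (mulmxA S) mulmxV// mul1mx.
    by rewrite mulr_ge0 ?invr_ge0 ?(ltW n0)//; exact: Scov_psd.
  apply: le_trans (ler_wpM2r Sy0 varS).
  have -> : n^-1 * bform S v v * (n^-1 * bform (invmx S) y y) =
    n^-1 ^+ 2 * (bform S v v * bform (invmx S) y y) by ring.
  by rewrite ler_wpM2l ?sqr_ge0.
set s := n^-1 * _; have : `|contrast Nq Y F u i q| <= sigmaF * Num.sqrt s.
  rewrite -sqrtr_sqr -[sigmaF in leRHS]ger0_norm ?(le_trans ler01)//.
  by rewrite -sqrtr_sqr -sqrtrM ?sqr_ge0// ler_wsqrtr.
move/le_trans; apply; rewrite -mulrA ler_peMl ?mulr_ge0 ?sqrtr_ge0 ?(le_trans ler01)//.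
by lra.
Qed.

(** Since [W] squares to the inverse of [V], the squared length of [u] is the form of that inverse
    at [b], at most [(rho_min V)^-1]; the rest is [norm21_norminf]. *)
Lemma contrast_le_norm i q : `|contrast Nq Y F u i q| <=
  norm21 (F q) * ((Nq q)%:R)^-1 * norminf (Ybrev Y i q) / Num.sqrt (rho_min V).
Proof.
have A_sym : sym_mx (invmx V) by rewrite /sym_mx -WW trmx_mul W_sym.
have formA x : bform (invmx V) x x = norm2 (W *m x) ^+ 2.
  by rewrite -bform1_norm2 /bform mulmx1 -WW trmx_mul W_sym !mulmxA.
have A_pd : pd (invmx V).
  move=> x x0; rewrite -/(bform _ _ _) formA exprn_gt0// lt_def norm2_ge0 andbT.
  apply/eqP => /norm2_eq0 Wx; have := W_pd x0.
  by rewrite -mulmxA Wx mulmx0 mxE ltxx.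
have [rho0 b_le] := rho_min_bform V_unit A_sym A_pd b1.
have nu : norm2 u^T <= (Num.sqrt (rho_min V))^-1.
  move: b_le; rewrite formA -u_tr => h.
  by rewrite -sqrtrV ?(ltW rho0)// -(ger0_norm (norm2_ge0 _)) -sqrtr_sqr ler_wsqrtr.
have norminf0 (y : 'cV[R]_p) : 0 <= norminf y.
  by apply: (big_ind (fun x => 0 <= x)) => // x1 x2; rewrite le_max => ->.
have norm210 : 0 <= norm21 (F q) by apply: sumr_ge0 => k _; exact: norm2_ge0.
rewrite /contrast -scalemxAr mxE mulmxA normrM normfV normr_nat.
apply: (le_trans (ler_wpM2l _ (norm21_norminf _ _ _))); first by rewrite invr_ge0.
set k := (Nq q)%:R^-1; have k0 : 0 <= k by rewrite invr_ge0.
have := ler_wpM2l (mulr_ge0 (mulr_ge0 norm210 k0) (norminf0 (Ybrev Y i q))) nu.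
by apply: le_trans; rewrite le_eqVlt; apply/orP; left; apply/eqP; ring.
Qed.

End Standardized.

Theorem theoremS4 :
  forall R : realType, exists C : R, 0 < C /\
  forall (N Q p H : nat) (Nq : 'I_Q -> nat)
         (Y : 'I_N -> 'I_Q -> 'cV[R]_p) (F : 'I_Q -> 'M[R]_(H, p)),
    (forall q : 'I_Q, (0 < Nq q)%N) ->
    (\sum_(q < Q) Nq q)%N = N ->
    Vgamma Nq Y F \in unitmx ->
    (* W = V^{-1/2}: the symmetric positive definite square root of V^{-1} *)
    forall W : 'M[R]_H,
      sym_mx W -> pd W -> W *m W = invmx (Vgamma Nq Y F) ->
    let gtilde := fun z : {ffun 'I_N -> 'I_Q} =>
      W *m (gammahat Nq Y F z - expect_cr Nq (gammahat Nq Y F)) in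
    (* (i) *)
    (forall b : 'cV[R]_H, norm2 b = 1 -> forall t : R,
       `| prob_cr R Nq (fun z => (b^T *m gtilde z) 0 0 <= t) - Phi t |
       <= C * \big[Num.max/0]_(i < N) \big[Num.max/0]_(q < Q)
                `| (b^T *m W *m (((Nq q)%:R)^-1 *: (F q *m Ybrev Y i q))) 0 0 |)
    /\
    (* (ii) *)
    ((forall q : 'I_Q, Scov Y q q \in unitmx) ->
     forall sigmaF : R, 1 <= sigmaF ->
     psd (sigmaF ^+ 2 *: Vgamma Nq Y F
          - \sum_(q < Q) (((Nq q)%:R)^-1 *: (F q *m Scov Y q q *m (F q)^T))) ->
     forall b : 'cV[R]_H, norm2 b = 1 -> forall t : R,
       `| prob_cr R Nq (fun z => (b^T *m gtilde z) 0 0 <= t) - Phi t |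
       <= C * \big[Num.max/0]_(i < N) \big[Num.max/0]_(q < Q)
          Num.min
            (2 * sigmaF * Num.sqrt (((Nq q)%:R)^-1 *
               ((Ybrev Y i q)^T *m invmx (Scov Y q q) *m Ybrev Y i q) 0 0))
            (norm21 (F q) * ((Nq q)%:R)^-1 * norminf (Ybrev Y i q)
               / Num.sqrt (rho_min (Vgamma Nq Y F)))).
Proof.
move=> R; exists (2 * berry_esseen_cst R); split.
  by rewrite mulr_gt0// berry_esseen_cst_gt0.
move=> N Q p H Nq Y F Nq_gt0 sumNq V_unit W W_sym W_pd WW gtilde; split.
  by move=> b b1 t; exact: standardized_berry_esseen.
move=> S_unit sigmaF sF1 S_le b b1 t.
have be := standardized_berry_esseen Nq_gt0 sumNq V_unit W_sym WW b1 t.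
apply: (le_trans be); apply: ler_wpM2l.
  by rewrite mulr_ge0// ltW// berry_esseen_cst_gt0.
(* Both bounds hold for each pair [(i, q)] separately, so the minimum can be taken inside the
   maximum. *)
apply: bigmax2_le => i q; rewrite le_min; apply/andP; split.
  exact: contrast_le_leverage.
exact: contrast_le_norm.
Qed.
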